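(* The number of chromatic polynomials of planar triangulations with $n$ vertices grows exponentially in $n$. That is, if $a_n$ denotes the number of distinct polynomials $\chi_T(Q)$, where $T$ ranges over all planar triangulations with $n$ vertices, then there exist constants $1<c\le C$ such that $c^n\le a_n\le C^n$ for all sufficiently large $n$.
   Context: A planar triangulation is a finite connected graph $T$ embedded in the sphere $S^2$ such that every face is bounded by three edges; equivalently, the dual planar graph is cubic (multiple edges are allowed). The chromatic polynomial $\chi_T(Q)$ is the polynomial whose value at each positive integer $k$ is the number of proper vertex colorings of $T$ with $k$ colors. *)

(* Defs.v *)
From mathcomp Require Import all_boot all_order all_fingroup all_algebra.
From mathcomp Require Import finmap classical_sets cardinality reals.

Set Implicit Arguments.
Unset Strict Implicit.
Unset Printing Implicit Defensive.

Import GRing.Theory Num.Theory.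
Local Open Scope ring_scope.

(* A graph cellularly embedded in an oriented closed surface, given as usual by
   its rotation system.  A dart is an edge with a choice of direction, [edge]
   reverses a dart, and [node] sends a dart to the next dart with the same
   origin, in the cyclic order that the orientation induces around that
   origin.  Loops and multiple edges are representable. *)
Record rotation_system := RotationSystem {
  dart : finType;
  edge : {perm dart};
  node : {perm dart};
  edgeK : forall x, edge (edge x) = x;
  edge_neq : forall x, edge x != x
}.

(* Products in [{perm _}] compose from left to right: [face G x] is
   [node G (edge G x)], the dart following [x] along the boundary of the face
   on a fixed side of [x]. *)
Definition face (G : rotation_system) : {perm dart G} := (edge G * node G)%g.

Definition vertex (G : rotation_system) : finType :=
  {v : {set dart G} | v \in porbits (node G)}.

Definition origin (G : rotation_system) (x : dart G) : vertex G :=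
  exist _ (porbit (node G) x) (imset_f (porbit (node G)) (erefl true)).

Definition adjacent (G : rotation_system) : rel (vertex G) :=
  fun u v => [exists x, (origin x == u) && (origin (edge G x) == v)].

Definition connected_graph (G : rotation_system) : Prop :=
  forall u v : vertex G, connect (@adjacent G) u v.

(* The surface carrying a connected rotation system is the sphere exactly when
   its Euler characteristic is 2. *)
Definition spherical (G : rotation_system) : Prop :=
  (#|vertex G| + #|porbits (face G)| = #|porbits (edge G)| + 2)%N.

(* The sides of a face are counted with multiplicity: an edge with the same
   face on both sides contributes both of its darts to that face. *)
Definition planar_triangulation (G : rotation_system) : Prop :=
  [/\ connected_graph G, spherical G
    & forall x : dart G, #|porbit (face G) x| = 3%N].

Definition proper_colorings (G : rotation_system) (k : nat) :
    {set {ffun vertex G -> 'I_k}} :=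
  [set f : {ffun vertex G -> 'I_k} |
    [forall u, forall v, adjacent u v ==> (f u != f v)]].

Definition is_chromatic_polynomial (G : rotation_system) (p : {poly int}) :
    Prop :=
  forall k : nat, (0 < k)%N -> p.[k%:R] = #|proper_colorings G k|%:R.

Definition chromatic_polynomials (n : nat) : set {poly int} :=
  [set p | exists G : rotation_system,
     [/\ planar_triangulation G, #|vertex G| = n
       & is_chromatic_polynomial G p]]%classic.

(* [fset_set] of an infinite set is empty, so a positive lower bound on this
   number entails that the set is finite. *)
Definition num_chromatic_polynomials (n : nat) : nat :=
  #|` fset_set (chromatic_polynomials n)|%fset.

(* Main.v *)
Require Import Defs.
From mathcomp Require Import finmap classical_sets cardinality reals.
From mathcomp Require Import all_boot all_order all_fingroup all_algebra.
From mathcomp Require Import zify ring lra.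

(** Upper bound.  A sphere with n vertices and triangular faces has 6(n - 2)
    darts, and a connected spherical rotation system with m darts is described,
    up to isomorphism, by a word of length m over four letters; hence there are
    at most 4 ^ (6n) chromatic polynomials.  To get the word, contract the
    edges of a spanning tree: the vertex permutation becomes a single cycle, the
    contour of the tree, in which the darts receive positions 0, ..., m - 1
    [exists_spanning_tree].  Contracting an edge multiplies the permutation by a
    transposition, which changes the number of cycles by exactly one
    [porbits_flip]; counting cycles gives the Euler inequality
    [euler_inequality], and, in the spherical case, where all the counts are
    tight, it shows that the tree edges are pairwise noncrossing along the
    contour and that so are the other edges [edge_on_one_side].  A noncrossing
    matching is determined by the set of the smaller ends of its arcs
    [code_matching].  So it is enough to record, for each position, whether
    the dart belongs to the tree and whether it precedes its reverse
    [code_isomorphism].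

    Lower bound.  Start from a square a b c d cut along the diagonal b d, and
    repeatedly add outside a new corner d', joined to a, d, c, or a new corner
    c', joined to b, c, d; finally draw the diagonal a c outside.  Each word over
    these two moves gives a planar triangulation [disc_sphere].  The number of
    colourings of the disc which extend given colours of the corners depends
    only on whether a and c agree and whether b and d agree, and a move acts
    linearly on these four numbers [disc_coloringsE].  Hence the chromatic
    polynomial is Q (Q - 1) (Q - 2) h(Q) with h explicit, and at Q = 2 the two
    linear maps become, up to sign, (y, z) -> (y, y + z) and
    (y, z) -> (y + z, z): the two moves of the Stern-Brocot tree [weights2].
    Therefore the slope of the polynomial at 2 is, up to sign, twice an
    entry sum y + z of a node of that tree [slope2_disc].

    Exponentially many values y + z occur among the 2 ^ m words of length m.
    Distinct words have distinct pairs (y, z) of positive integers, so a value v is taken at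
    most v times, while the values add up to 2 * 3 ^ m; by the Cauchy-Schwarz
    inequality there are at least 4 ^ m / (2 * 3 ^ m) of them
    [many_stern_sums]. *)

Set Implicit Arguments.
Unset Strict Implicit.
Unset Printing Implicit Defensive.

Import Order.TTheory GRing.Theory Num.Theory.
Local Open Scope ring_scope.

(** * Contracting edges of a rotation system *)

Section Flips.
Local Open Scope nat_scope.
Variables (D : finType) (e : {perm D}).
Hypotheses (eK : involutive e) (e_neq : forall x, e x != x).

Definition norbits (s : {perm D}) : nat := #|porbits s|.

Lemma norbits_tperm (s : {perm D}) x :
  norbits (tperm x (e x) * s)%g + (e x \notin porbit s x).*2 = (norbits s).+1.
Proof.
have /= := porbits_mul_tperm s x (e x).
by rewrite porbit_sym eq_sym e_neq /norbits addn1.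
Qed.

(** Sets of darts that are unions of edges. *)
Definition edge_closed (A : {set D}) := forall x, (e x \in A) = (x \in A).

(** Testing both darts makes this an involution even when [A] cuts an edge. *)
Definition flip_fun (A : {set D}) x :=
  if (x \in A) && (e x \in A) then e x else x.

Lemma flip_funK A : involutive (flip_fun A).
Proof.
move=> x; rewrite /flip_fun.
by case AAx: ((x \in A) && (e x \in A)); rewrite ?eK ?AAx // andbC AAx.
Qed.

(** Passing from [s] to [flip A * s] splices the cycles at both ends of each
    edge of [A]: if [s] turns around vertices and [A] is a forest, this is the
    contraction of [A]. *)
Definition flip A : {perm D} := perm (inv_inj (flip_funK A)).

Lemma flipE A x : edge_closed A -> flip A x = if x \in A then e x else x.
Proof. by move=> cA; rewrite permE /flip_fun cA andbb. Qed.

Lemma flipK A : (flip A * flip A = 1)%g.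
Proof. by apply/permP => x; rewrite permM !permE flip_funK. Qed.

Lemma edge_closedD1 A x : edge_closed A -> edge_closed (A :\: [set x; e x]).
Proof.
move=> cA y; rewrite !inE cA (inj_eq perm_inj) -{1}(eK x) (inj_eq perm_inj).
by rewrite [(_ == e x) || _]orbC.
Qed.

Lemma edge_closedC A : edge_closed A -> edge_closed (~: A).
Proof. by move=> cA y; rewrite !inE cA. Qed.

Lemma card_pairD A x : edge_closed A -> x \in A ->
  #|A| = #|A :\: [set x; e x]|.+2.
Proof.
move=> cA Ax; rewrite -(cardsID [set x; e x] A).
have /setIidPr -> : [set x; e x] \subset A.
  by apply/subsetP => y /set2P[]->; rewrite ?cA.
by rewrite cards2 eq_sym e_neq.
Qed.

Lemma flip_split A x : edge_closed A -> x \in A ->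
  flip A = (tperm x (e x) * flip (A :\: [set x; e x]))%g.
Proof.
move=> cA Ax; apply/permP => y; rewrite permM flipE //.
rewrite flipE; last exact: edge_closedD1.
case: tpermP => [->|->|/eqP yx /eqP yex].
- by rewrite Ax !inE eqxx orbT.
- by rewrite cA Ax eK !inE eqxx.
- by rewrite !inE (negPf yx) (negPf yex).
Qed.

Lemma flip_splitM A (s : {perm D}) x : edge_closed A -> x \in A ->
  (flip A * s = tperm x (e x) * (flip (A :\: [set x; e x]) * s))%g.
Proof. by move=> cA Ax; rewrite mulgA -flip_split. Qed.

Lemma flip_splitr A x : edge_closed A -> x \in A ->
  flip A = (flip (A :\: [set x; e x]) * tperm x (e x))%g.
Proof.
have flipV B : flip B = (flip B)^-1%g by rewrite -[RHS]mulg1 -(flipK B) mulKg.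
by move=> cA Ax; rewrite flipV (flip_split cA Ax) invMg tpermV -flipV.
Qed.

Lemma flip_add A x : edge_closed A -> x \notin A ->
  edge_closed (A :|: [set x; e x]) /\
  flip (A :|: [set x; e x]) = (tperm x (e x) * flip A)%g.
Proof.
move=> cA Ax.
have cB : edge_closed (A :|: [set x; e x]).
  move=> y; rewrite !inE cA (inj_eq perm_inj) -{1}(eK x) (inj_eq perm_inj).
  by rewrite [(_ == e x) || _]orbC.
split=> //; rewrite (flip_split cB (x := x)) ?inE ?eqxx ?orbT //.
have -> // : (A :|: [set x; e x]) :\: [set x; e x] = A.
apply/setP => y; rewrite !inE.
have [->|_] := eqVneq y x; first by rewrite (negPf Ax).
have [->|_] := eqVneq y (e x); first by rewrite cA (negPf Ax).
by rewrite /= orbF.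
Qed.

Lemma flip0 : flip set0 = 1%g.
Proof. by apply/permP => x; rewrite permE /flip_fun inE perm1. Qed.

(** [flip A] is a product of [#|A| / 2] transpositions, and multiplying by a
    transposition creates at most one new cycle. *)
Lemma porbits_flip A (s : {perm D}) : edge_closed A ->
  (norbits (flip A * s)%g).*2 <= (norbits s).*2 + #|A|.
Proof.
have [n] := ubnP #|A|; elim: n A s => // n IHn A s ltA cA.
have [->|[x Ax]] := set_0Vmem A; first by rewrite flip0 mul1g cards0 addn0.
have cB := edge_closedD1 x cA; have cardA := card_pairD cA Ax.
rewrite (flip_splitM _ cA Ax).
set B := A :\: _ in cB cardA *.
have := norbits_tperm (flip B * s)%g x.
have := IHn B s ltac:(lia) cB.
by case: (_ \notin _) => /=; lia.
Qed.

Lemma porbits_flip_ge A (s : {perm D}) : edge_closed A ->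
  (norbits s).*2 <= (norbits (flip A * s)%g).*2 + #|A|.
Proof.
move=> cA; have := porbits_flip (flip A * s)%g cA.
by rewrite mulgA flipK mul1g.
Qed.

(** The group generated by [e] and [s] is transitive, in a form that does not
    mention the group. *)
Definition transitive_pair (s : {perm D}) :=
  forall P : pred D, (forall x, P (e x) = P x) -> (forall x, P (s x) = P x) ->
  forall x y, P x = P y.

(** [A] is a forest: contracting any of its edges merges two vertices. *)
Definition merging s (A : {set D}) :=
  [&& [forall x, (e x \in A) == (x \in A)] &
      (norbits (flip A * s)%g).*2 + #|A| == (norbits s).*2].

Lemma merging0 s : merging s set0.
Proof.
apply/andP; split; last by rewrite flip0 mul1g cards0 addn0.
by apply/forallP => x; rewrite !inE.
Qed.

Lemma porbits_single t (x0 : D) : (forall x, x \in porbit t x0) -> norbits t = 1.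
Proof.
move=> single.
apply/eqP/cards1P; exists (porbit t x0); apply/setP => S; rewrite inE.
apply/imsetP/eqP => [[y _ ->]|->]; last by exists x0.
by apply/eqP; rewrite eq_porbit_mem.
Qed.

(** A forest [A] of maximal size does it.  An edge outside [A] lies in one cycle of
    [flip A * s], otherwise it could be added; an edge in [A] does too,
    because removing it increases the number of cycles.  So the cycles are
    stable under [e] and [s], and transitivity leaves only one. *)
Lemma exists_spanning_tree s (x0 : D) : transitive_pair s ->
  exists A, [/\ edge_closed A,
    (norbits s).*2 = #|A|.+2 & forall x, x \in porbit (flip A * s) x0].
Proof.
move=> conn.
have [A /andP[/forallP cA' /eqP cardA] maxA] : exists2 A : {set D},
    merging s A & forall B : {set D}, merging s B -> #|B| <= #|A|.
  case: (arg_maxnP (fun A : {set D} => #|A|) (merging0 s)) => A mA maxA.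
  by exists A.
have cA : edge_closed A by move=> x; apply/eqP.
set t := (flip A * s)%g in cardA.
have joined x : e x \in porbit t x.
  have [Ax|Ax] := boolP (x \in A).
    have cB := edge_closedD1 x cA.
    have := porbits_flip_ge s cB; have := card_pairD cA Ax.
    have := norbits_tperm (flip (A :\: [set x; e x]) * s)%g x.
    have := norbits_tperm t x.
    have Et: (tperm x (e x) * (flip (A :\: [set x; e x]) * s))%g = t.
      by rewrite -flip_splitM.
    rewrite Et -[in (tperm x (e x) * t)%g]Et tpermKg; move: cardA.
    by case: (e x \in _) => //=; lia.
  have [cB flipB] := flip_add cA Ax.
  apply: contraT => nex.
  have cards : norbits (flip (A :|: [set x; e x]) * s)%g + 2 = norbits t + 1.
    rewrite flipB -mulgA -/t.
    by have := norbits_tperm t x; rewrite nex addn1.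
  have cardB : #|A :|: [set x; e x]| = #|A|.+2.
    rewrite (card_pairD cB (x := x)) ?inE ?eqxx ?orbT //.
    have -> // : (A :|: [set x; e x]) :\: [set x; e x] = A.
    apply/setP => y; rewrite !inE.
    have [->|_] := eqVneq y x; first by rewrite (negPf Ax).
    have [->|_] := eqVneq y (e x); first by rewrite cA (negPf Ax).
    by rewrite /= orbF.
  have /maxA : merging s (A :|: [set x; e x]).
    apply/andP; split; first by apply/forallP => y; rewrite cB.
    apply/eqP; move: cards cardA; rewrite cardB; lia.
  by rewrite cardB; lia.
have orb1 x : porbit t (t x) = porbit t x.
  by have := porbit_perm t 1 x; rewrite expg1.
have orbe x : porbit t (e x) = porbit t x by apply/eqP; rewrite eq_porbit_mem.
have orbs x : porbit t (s x) = porbit t x.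
  have -> : s x = t (flip A x) by rewrite permM -[flip A (flip A x)]permM flipK perm1.
  rewrite orb1 flipE //; case: ifP => // _; exact: orbe.
have single x : x \in porbit t x0.
  have := conn (fun y => y \in porbit t x0).
  move=> /(_ _ _ x x0) ->; rewrite ?porbit_id // => y;
  by rewrite -!eq_porbit_mem ?orbe ?orbs.
exists A; split=> //.
by move: cardA; rewrite (porbits_single single); lia.
Qed.

Lemma flip_compl A (s : {perm D}) : edge_closed A -> (flip (~: A) * (flip A * s) = e * s)%g.
Proof.
move=> cA; apply/permP => x; rewrite !permM (flipE _ cA).
rewrite (flipE _ (edge_closedC cA)) inE.
by case Ax: (x \in A); rewrite /= ?cA Ax.
Qed.

(** Contracting a spanning tree turns the vertices into one cycle; the
    remaining edges then split it into the faces, at most one new face each. *)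
Lemma euler_inequality s (x0 : D) : transitive_pair s ->
  (norbits s).*2 + (norbits (e * s)%g).*2 <= #|D| + 4.
Proof.
move=> /(exists_spanning_tree x0)[A [cA cardA /porbits_single single]].
have := porbits_flip (flip A * s)%g (edge_closedC cA).
rewrite flip_compl // single; have := cardsC A; lia.
Qed.

(** If each of the [#|A| / 2] transpositions splits a cycle, they do so in
    every order.  Multiply first by the edge of [x], then by the edge of [y]: the latter
    still splits, so both its darts are in the same cycle after the first
    splitting, that is, the two edges do not cross. *)
Lemma edge_on_one_side A (t : {perm D}) x y : edge_closed A ->
  (norbits (flip A * t)%g).*2 = (norbits t).*2 + #|A| ->
  x \in A -> y \in A -> y != x -> y != e x ->
  e y \in porbit (tperm x (e x) * t)%g y.
Proof.
move=> cA cardt Ax Ay yx yex.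
have cB := edge_closedD1 x cA; set B := A :\: _ in cB.
have By : y \in B by rewrite !inE (negPf yx) (negPf yex).
have cC := edge_closedD1 y cB; set C := B :\: _ in cC.
have cardB := card_pairD cA Ax; have cardC := card_pairD cB By.
rewrite -/B -/C in cardB cardC.
pose u : {perm D} := (tperm x (e x) * t)%g.
have EA : (flip A * t = flip C * (tperm y (e y) * u))%g.
  by rewrite (flip_splitr cA Ax) -/B (flip_splitr cB By) -/C !mulgA.
have := porbits_flip (tperm y (e y) * u)%g cC.
have := norbits_tperm u y; have := norbits_tperm t x; rewrite -/u.
rewrite -EA cardt; case: (e x \notin _) => /=; case: (e y \in _) => //=; lia.
Qed.

End Flips.

(** * The contour of a spanning tree in the planar case *)

Section Planar.
Local Open Scope nat_scope.

Lemma card_porbits_const (D : finType) (s : {perm D}) c :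
  (forall x, #|porbit s x| = c) -> norbits s * c = #|D|.
Proof.
move=> cardc; rewrite -[RHS]cardsT.
have part : partition (porbits s) [set: D].
  have -> : porbits s = equivalence_partition (fun x y => y \in porbit s x) [set: D].
    apply/setP => S; apply/imsetP/imsetP => -[x _ ->]; exists x => //;
    by apply/setP => y; rewrite !inE.
  apply: equivalence_partitionP => x y z _ _ _; split; first exact: porbit_id.
  by rewrite -eq_porbit_mem => /eqP->.
rewrite (card_uniform_partition (n := c) _ part) //.
by move=> S /imsetP[x _ ->].
Qed.

Lemma card_edge_porbit (G : rotation_system) x : #|porbit (edge G) x| = 2.
Proof.
have -> : porbit (edge G) x = [set x; edge G x].
  apply/setP => y; rewrite !inE; apply/porbitP/orP => [[i ->]|[/eqP->|/eqP->]].
  - elim: i => [|i IHi]; first by left; rewrite expg0 perm1.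
    rewrite expgSr permM; by case: IHi => /eqP->; [right | left; rewrite edgeK].
  - by exists 0; rewrite expg0 perm1.
  - by exists 1; rewrite expg1.
by rewrite cards2 eq_sym edge_neq.
Qed.

Lemma card_vertex (G : rotation_system) : #|vertex G| = norbits (node G).
Proof. by rewrite card_sig /norbits; apply: eq_card => x; rewrite inE. Qed.

Lemma origin_eq (G : rotation_system) (x y : dart G) :
  (origin x == origin y) = (x \in porbit (node G) y).
Proof. by rewrite -val_eqE /= eq_porbit_mem. Qed.

Lemma origin_node (G : rotation_system) (x : dart G) :
  origin (node G x) = origin x.
Proof. by apply/eqP; rewrite origin_eq -{1}[node G]expg1 mem_porbit. Qed.

Lemma origin_surj (G : rotation_system) (v : vertex G) : exists x, origin x = v.
Proof.
case: v => S pS; have /imsetP[x _ ES] := pS.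
by exists x; apply: val_inj.
Qed.

Lemma porbit_invariant (D : finType) (T : Type) (s : {perm D}) (f : D -> T) :
  (forall x, f (s x) = f x) -> forall x y, y \in porbit s x -> f y = f x.
Proof.
move=> fs x y /porbitP[i ->]; elim: i => [|i IHi]; first by rewrite expg0 perm1.
by rewrite expgSr permM fs.
Qed.

Lemma connected_transitive (G : rotation_system) :
  connected_graph G -> transitive_pair (edge G) (node G).
Proof.
move=> conn P Pe Pn x y.
have Po u v : origin u = origin v -> P u = P v.
  by move/eqP; rewrite origin_eq; apply: porbit_invariant.
have /connectP[p] := conn (origin x) (origin y).
elim: p x => [|w p IHp] x /= ; first by move=> _ /Po->.
case/andP => /existsP[z /andP[/eqP zx /eqP zw]] pth lst.
by rewrite -(Po _ _ zx) -Pe; apply: IHp; rewrite zw.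
Qed.

(** Positions along a permutation with a single cycle. *)
Lemma exists_position (D : finType) (t : {perm D}) x0 :
  (forall x, x \in porbit t x0) ->
  exists pos : D -> nat, [/\ injective pos, forall x, pos x < #|D|
    & forall x, pos (t x) = if (pos x).+1 == #|D| then 0 else (pos x).+1].
Proof.
move=> single.
have cardD : #|porbit t x0| = #|D|.
  by rewrite -cardsT; congr #|pred_of_set _|; apply/setP => x; rewrite inE single.
pose o := traject t x0 #|D|.
have memo x : x \in o by rewrite /o -cardD -porbit_traject single.
have uo : uniq o by rewrite /o -cardD uniq_traject_porbit.
have so : size o = #|D| by rewrite size_traject.
have lto x : index x o < #|D| by rewrite -so index_mem.
exists (index^~ o); split=> // [x y /(congr1 (nth x0 o))|x].
  by rewrite !nth_index.
have Ex : t x = iter (index x o).+1 t x0.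
  by rewrite iterS -(nth_traject t (lto x)) nth_index.
case: eqP => [E|/eqP E].
  rewrite Ex E -cardD iter_porbit -[x in index x _]/(nth x0 (x0 :: behead o) 0).
  have Eo : o = x0 :: behead o by rewrite /o; case: (#|D|) (lto x).
  by rewrite -Eo index_uniq // so (leq_ltn_trans _ (lto x)).
have lt1 : (index x o).+1 < #|D| by rewrite ltn_neqAle E lto.
by rewrite Ex -(nth_traject t lt1) index_uniq // so.
Qed.

(** The Euler characteristic 2 is the equality case: seen from the contour
    cycle [t], every edge of the tree splits when it is uncontracted and gives
    back the vertices, and every other edge splits and gives the faces. *)
Lemma planar_spanning_tree (G : rotation_system) (x0 : dart G) :
  connected_graph G -> spherical G ->
  exists A, let t := (flip (@edgeK G) A * node G)%g in
    [/\ edge_closed (edge G) A, forall x, x \in porbit t x0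
     & forall B, B = A \/ B = ~: A ->
       (norbits (flip (@edgeK G) B * t)%g).*2 = (norbits t).*2 + #|B|].
Proof.
move=> /connected_transitive conn sph.
have [A [cA cardA single]] := exists_spanning_tree (@edgeK G) (@edge_neq G) x0 conn.
exists A; split=> // B.
have two := card_porbits_const (card_edge_porbit (G := G)).
rewrite (porbits_single single) => -[] ->.
  rewrite [X in norbits X](_ : _ = node G); first by rewrite /norbits cardA; lia.
  by rewrite mulgA flipK mul1g.
have -> := flip_compl (@edgeK G) (node G) cA.
have := sph; rewrite /spherical card_vertex -/(norbits (face G)) -/(norbits (edge G)).
rewrite /face; have := cardsC A; have := cardA; rewrite -/(norbits (node G)); lia.
Qed.

End Planar.

(** * Words for planar rotation systems *)

Section Code.
Local Open Scope nat_scope.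

Definition code m := {ffun 'I_m -> bool * bool}.

(** The letter at a position tells whether the dart there is in the spanning
    tree, and whether it precedes its reverse; [pos] numbers the darts along the
    contour of the tree, whose next dart after [x] is [node G (edge G x)] if
    [x] is in the tree and [node G x] otherwise. *)
Record encodes (G : rotation_system) m (c : code m) (pos : dart G -> 'I_m) : Prop := Encodes {
  pos_bij : bijective pos;
  pos_next : forall x,
    pos (node G (if (c (pos x)).1 then edge G x else x)) =
      (if (pos x).+1 == m then 0 else (pos x).+1) :> nat;
  same_class : forall x, (c (pos (edge G x))).1 = (c (pos x)).1;
  opener : forall x, (c (pos x)).2 = (pos x < pos (edge G x));
  nested : forall x y, (c (pos x)).1 = (c (pos y)).1 ->
    pos x < pos y < pos (edge G x) -> pos x < pos (edge G y) < pos (edge G x)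
}.

(** The edge of [x] cuts the contour into two arcs, each of which is a cycle
    once the edge has been split off; [edge_on_one_side] keeps every edge of the same
    class inside one arc. *)
Lemma exists_code (G : rotation_system) m :
  connected_graph G -> spherical G -> #|dart G| = m ->
  exists c : code m, exists pos : dart G -> 'I_m, encodes c pos.
Proof.
move=> conn sph cardD.
have [x0 _ | D0] := pickP (dart G); last first.
  have no_dart (T : finType) (f : dart G -> T) : #|f @: dart G| = 0.
    by apply/eqP; rewrite cards_eq0; apply/eqP/setP => z; rewrite inE;
      apply/imsetP => -[x]; rewrite -[_ \in _]/(true) => _; have := D0 x.
  by move: sph; rewrite /spherical card_vertex /norbits /porbits !no_dart.
have [A [cA single split]] := planar_spanning_tree x0 conn sph.
set t := (_ * node G)%g in single split.
have [pos [pos_inj pos_lt pos_t]] := exists_position single.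
have ltm x : pos x < m by rewrite -cardD.
have pbij : bijective (fun x => Ordinal (ltm x)).
  apply: inj_card_bij; last by rewrite card_ord cardD.
  by move=> x y /(congr1 val) /pos_inj.
have [dt posK dtK] := pbij.
exists [ffun i => (dt i \in A, i < pos (edge G (dt i)))].
exists (fun x => Ordinal (ltm x)).
have inA x : (dt (Ordinal (ltm x)) \in A) = (x \in A) by rewrite posK.
split=> // [x|x|x|x y]; rewrite !ffunE /= ?inA.
- rewrite -cardD -pos_t; congr (pos _).
  by rewrite /t permM flipE.
- exact: cA.
- by rewrite posK.
move=> xyA /andP[xy yex].
have xex := ltn_trans xy yex.
have nyx : y != x by apply: contraTneq xy => ->; rewrite ltnn.
have nyex : y != edge G x by apply: contraTneq yex => ->; rewrite ltnn.
have : edge G y \in porbit (tperm x (edge G x) * t)%g y.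
  case Ax: (x \in A) xyA => /esym Ay.
    exact: (edge_on_one_side (@edge_neq G) cA (split A (or_introl erefl))).
  have [Acx Acy] : x \in ~: A /\ y \in ~: A by rewrite !inE Ax Ay.
  exact: (edge_on_one_side (@edge_neq G) (edge_closedC cA) (split _ (or_intror erefl))).
move/(porbit_invariant (f := fun u => pos x < pos u <= pos (edge G x))).
rewrite xy (ltnW yex) /= => inside.
suff /inside/andP[-> le] : forall u,
    (pos x < pos ((tperm x (edge G x) * t)%g u) <= pos (edge G x)) =
    (pos x < pos u <= pos (edge G x)).
  rewrite ltn_neqAle le andbT; apply: contra nyx => /eqP/pos_inj.
  by move=> eyx; rewrite -(inj_eq (@perm_inj _ (edge G))) eyx.
move=> u; rewrite permM pos_t.
have [->|->|/eqP ux /eqP uex] := tpermP; have := pos_lt (edge G x).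
- by case: eqP => [|_]; lia.
- have := pos_lt x; case: eqP => [|_]; lia.
- have pux : pos u != pos x by rewrite (inj_eq pos_inj).
  have puex : pos u != pos (edge G x) by rewrite (inj_eq pos_inj).
  by have := pos_lt u; case: eqP => [|_]; lia.
Qed.

Lemma pos_val_inj (G : rotation_system) m (c : code m) (pos : dart G -> 'I_m) x y :
  encodes c pos -> pos x = pos y :> nat -> x = y.
Proof. by move=> enc /val_inj /(bij_inj (pos_bij enc)). Qed.

Lemma edge_pos_neq (G : rotation_system) m (c : code m) (pos : dart G -> 'I_m) x :
  encodes c pos -> pos (edge G x) != pos x :> nat.
Proof.
move=> enc; apply/eqP => /(pos_val_inj enc)/eqP; exact/negP/edge_neq.
Qed.

Lemma pos_val_surj (G : rotation_system) m (c : code m) (pos : dart G -> 'I_m)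
  (i : 'I_m) : encodes c pos -> exists x, pos x = i.
Proof. by move=> enc; have [g _ gK] := pos_bij enc; exists (g i). Qed.

(** In a noncrossing matching a closing dart is matched with the last dart of
    its class which is still open.  If the partner of [x] were earlier in [G] than
    in [G'], the dart of [G] at the position of the partner in [G'] would be
    nested inside the edge of [x]; its own closing dart comes before [x], where
    both matchings agree, and [G'] would match that position twice. *)
Lemma partner_not_below (G G' : rotation_system) m (c : code m)
    (pos : dart G -> 'I_m) (pos' : dart G' -> 'I_m) x x' :
  encodes c pos -> encodes c pos' -> pos x = pos' x' ->
  (forall y y', pos y < pos x -> pos y = pos' y' ->
     pos (edge G y) < pos y -> pos (edge G y) = pos' (edge G' y')) ->
  pos (edge G x) < pos x -> pos (edge G x) < pos' (edge G' x') -> False.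
Proof.
move=> enc enc' Exx' IH clx lt.
have clx' : pos' (edge G' x') < pos' x'.
  have := edge_pos_neq x' enc'.
  have := opener enc x; have := opener enc' x'; rewrite -Exx' => ->.
  by lia.
have [y Ey] := pos_val_surj (pos' (edge G' x')) enc.
have opy : pos y < pos (edge G y).
  by rewrite -(opener enc) Ey (opener enc') edgeK.
have /andP[_ eyx] : pos (edge G x) < pos (edge G y) < pos (edge G (edge G x)).
  apply: (nested enc).
    by rewrite (same_class enc) Ey (same_class enc') Exx'.
  by rewrite edgeK Ey lt Exx'.
rewrite edgeK in eyx.
have [y' Ey'] := pos_val_surj (pos (edge G y)) enc'.
have := IH (edge G y) y' eyx (esym Ey'); rewrite edgeK => /(_ opy).
rewrite Ey => /(congr1 val) /(pos_val_inj enc') /perm_inj Exy'.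
by move: eyx; rewrite -Ey' -Exy' -Exx' ltnn.
Qed.

(** Closing darts are treated by induction on their position, and every opening
    dart is the partner of a closing one. *)
Lemma code_matching (G G' : rotation_system) m (c : code m)
    (pos : dart G -> 'I_m) (pos' : dart G' -> 'I_m) :
  encodes c pos -> encodes c pos' ->
  forall x x', pos x = pos' x' -> pos (edge G x) = pos' (edge G' x').
Proof.
move=> enc enc'.
have closer x x' : pos x = pos' x' -> pos (edge G x) < pos x ->
    pos (edge G x) = pos' (edge G' x').
  have [n] := ubnP (pos x); elim: n x x' => // n IHn x x' ltx Exx' clx.
  have clx' : pos' (edge G' x') < pos' x'.
    have := edge_pos_neq x' enc'.
    have := opener enc x; have := opener enc' x'; rewrite -Exx' => ->.
    by lia.
  apply: val_inj => /=.
  have [lt|lt|//] := ltngtP (pos (edge G x)) (pos' (edge G' x')).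
    case: (partner_not_below enc enc' Exx' _ clx lt) => y y' yx Eyy' cly.
    by apply: IHn => //; lia.
  case: (partner_not_below enc' enc (esym Exx') _ clx' lt) => y' y yx Eyy' cly.
  apply/esym/IHn => //; rewrite -?Eyy'; first by move: yx; rewrite -Exx'; lia.
  have := edge_pos_neq y enc; have := opener enc' y'; have := opener enc y.
  by rewrite -Eyy' => ->; lia.
move=> x x' Exx'.
have [lt|lt|E] := ltngtP (pos (edge G x)) (pos x).
- exact: closer.
- have [y' Ey'] := pos_val_surj (pos (edge G x)) enc'.
  have := closer (edge G x) y' (esym Ey'); rewrite edgeK Exx' in lt * => /(_ lt).
  move=> /(congr1 val) /(pos_val_inj enc') ->.
  by rewrite edgeK.
- by have := edge_pos_neq x enc; rewrite E eqxx.
Qed.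

Lemma code_isomorphism (G G' : rotation_system) m (c : code m)
    (pos : dart G -> 'I_m) (pos' : dart G' -> 'I_m) :
  encodes c pos -> encodes c pos' ->
  exists h : dart G -> dart G', [/\ bijective h,
    forall x, h (edge G x) = edge G' (h x) &
    forall x, h (node G x) = node G' (h x)].
Proof.
move=> enc enc'; have [g' pK gK] := pos_bij enc'; have [g qK hK] := pos_bij enc.
exists (g' \o pos); split=> [|x|x] /=.
- by exists (g \o pos') => x /=; rewrite ?gK ?qK ?hK ?pK.
- have E : pos x = pos' (g' (pos x)) by rewrite gK.
  by rewrite (code_matching enc enc' E) pK.
- apply: (bij_inj (pos_bij enc')); rewrite gK.
  pose z := if (c (pos x)).1 then edge G x else x.
  have Ez : (if (c (pos z)).1 then edge G z else z) = x.
    rewrite /z; case cx: (c (pos x)).1; last by rewrite cx.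
    by rewrite (same_class enc) cx edgeK.
  pose z' := g' (pos z); have E : pos z = pos' z' by rewrite gK.
  have Ez' : (if (c (pos' z')).1 then edge G' z' else z') = g' (pos x).
    apply: (bij_inj (pos_bij enc')); rewrite gK -E -[in RHS]Ez.
    by case: ifP => // _; rewrite (code_matching enc enc' E).
  apply: val_inj => /=; rewrite -[x in LHS]Ez -Ez'.
  by rewrite (pos_next enc) (pos_next enc') E.
Qed.

End Code.

Section Colorings.

(** Only the partition of the darts by their origin matters, so the vertices may be
    replaced by any set of labels which induces the same partition. *)
Lemma card_proper_colorings (G : rotation_system) (L : finType)
    (lab : dart G -> L) k :
  (forall v, exists x, lab x = v) ->
  (forall x y, (lab x == lab y) = (origin x == origin y)) ->
  #|proper_colorings G k| =
  #|[set g : {ffun L -> 'I_k} | [forall x, g (lab x) != g (lab (edge G x))]]|.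
Proof.
move=> lab_surj labP.
pose dv (v : vertex G) := sval (sig_eqW (origin_surj v)).
have dvK v : origin (dv v) = v by rewrite /dv; case: sig_eqW.
pose dl (v : L) := sval (sig_eqW (lab_surj v)).
have dlK v : lab (dl v) = v by rewrite /dl; case: sig_eqW.
have labE x : lab (dv (origin x)) = lab x by apply/eqP; rewrite labP dvK.
have orE x : origin (dl (lab x)) = origin x by apply/eqP; rewrite -labP dlK.
pose F (g : {ffun L -> 'I_k}) := [ffun v : vertex G => g (lab (dv v))].
pose F' (f : {ffun vertex G -> 'I_k}) := [ffun v : L => f (origin (dl v))].
have FK : cancel F F' by move=> g; apply/ffunP => v; rewrite !ffunE labE dlK.
have F'K : cancel F' F by move=> g; apply/ffunP => v; rewrite !ffunE orE dvK.
rewrite -(card_imset _ (can_inj F'K)); apply: eq_card => g; rewrite inE.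
apply/imsetP/forallP => [[f + ->] x|ok].
  rewrite inE !ffunE !orE => /forallP/(_ (origin x))/forallP/(_ (origin (edge G x))).
  by move/implyP; apply; apply/existsP; exists x; rewrite !eqxx.
exists (F g); last by rewrite FK.
rewrite inE; apply/forallP => u; apply/forallP => v; apply/implyP.
case/existsP => x /andP[/eqP <- /eqP <-]; rewrite !ffunE !labE.
exact: ok.
Qed.

Lemma isomorphic_proper_colorings (G G' : rotation_system)
    (h : dart G -> dart G') k : bijective h ->
  (forall x, h (edge G x) = edge G' (h x)) ->
  (forall x, h (node G x) = node G' (h x)) ->
  #|proper_colorings G k| = #|proper_colorings G' k|.
Proof.
move=> [h' hK h'K] he hn.
have hX i x : h ((node G ^+ i)%g x) = (node G' ^+ i)%g (h x).
  by elim: i => [|i IHi]; rewrite ?expg0 ?perm1 // !expgSr !permM hn IHi.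
rewrite (card_proper_colorings (lab := fun x => origin (h x))); first last.
- move=> x y; rewrite !origin_eq; apply/porbitP/porbitP => -[i E]; exists i.
    by apply: (can_inj hK); rewrite E hX.
  by rewrite E hX.
- by move=> v; have [x <-] := origin_surj v; exists (h' x); rewrite h'K.
apply: eq_card => f; rewrite !inE; apply/forallP/forallP => ok.
  move=> u; apply/forallP => v; apply/implyP => /existsP[x /andP[/eqP <- /eqP <-]].
  by have := ok (h' x); rewrite he h'K.
move=> x; have /forallP/(_ (origin (edge G' (h x))))/implyP := ok (origin (h x)).
by rewrite he; apply; apply/existsP; exists (h x); rewrite !eqxx.
Qed.

Lemma chromatic_polynomial_unique G p q :
  is_chromatic_polynomial G p -> is_chromatic_polynomial G q -> p = q.
Proof.
move=> Pp Pq; apply/eqP; rewrite -subr_eq0; apply/eqP.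
apply: (@roots_geq_poly_eq0 _ _ [seq k.+1%:R | k <- iota 0 (size (p - q))]).
- apply/allP => _ /mapP[k _ ->]; rewrite rootE hornerD hornerN Pp // Pq //.
  by rewrite subrr.
- rewrite map_inj_uniq ?iota_uniq // => i j /eqP.
  by rewrite eqr_nat eqSS => /eqP.
- by rewrite size_map size_iota.
Qed.

End Colorings.

(** * The exponential upper bound *)

Section Upper.
Local Open Scope nat_scope.

Lemma card_darts (G : rotation_system) :
  planar_triangulation G -> #|dart G| = 6 * (#|vertex G| - 2).
Proof.
case=> _ sph tri.
have := card_porbits_const tri.
have := card_porbits_const (card_edge_porbit (G := G)).
have := sph; rewrite /spherical card_vertex -/(norbits (face G)) -/(norbits (edge G)).
lia.
Qed.

(** A word determines the polynomial because it determines the rotation system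
    up to isomorphism. *)
Definition code_gives n (c : code (6 * (n - 2))) (p : {poly int}) :=
  exists (G : rotation_system) (pos : dart G -> 'I_(6 * (n - 2))),
    encodes c pos /\ is_chromatic_polynomial G p.

Lemma code_gives_inj n (c : code (6 * (n - 2))) p q :
  code_gives c p -> code_gives c q -> p = q.
Proof.
move=> [G [pos [enc Pp]]] [G' [pos' [enc' Pq]]].
have [h [hb he hn]] := code_isomorphism enc enc'.
apply: (chromatic_polynomial_unique (G := G')) => // k k0.
by rewrite Pp // (isomorphic_proper_colorings k hb he hn).
Qed.

Lemma chromatic_polynomials_coded n :
  exists f : code (6 * (n - 2)) -> {poly int},
    forall p, chromatic_polynomials n p -> exists c, f c = p.
Proof.
pose f (c : code (6 * (n - 2))) := xget (0 : {poly int})%R [set p | code_gives c p]%classic.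
exists f => p [G [triG nG Gp]].
have [c [pos enc]] := exists_code (let: And3 a _ _ := triG in a)
  (let: And3 _ b _ := triG in b) (card_darts triG).
rewrite nG in c pos enc; have cp : code_gives c p by exists G, pos.
exists c; apply: (code_gives_inj (c := c)) => //.
by rewrite /f; case: xgetP => [q ->|/(_ p)].
Qed.

Lemma finite_chromatic_polynomials n : finite_set (chromatic_polynomials n).
Proof.
have [f fP] := chromatic_polynomials_coded n.
apply: (@sub_finite_set _ _ (f @` classical_sets.setT)%classic) => [p /fP[c <-]|]; first by exists c.
exact/finite_image/finite_finset.
Qed.

Lemma num_chromatic_polynomials_le n :
  num_chromatic_polynomials n <= 4 ^ (6 * n).
Proof.
have [f fP] := chromatic_polynomials_coded n.
have : num_chromatic_polynomials n <= size (codom f).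
  apply: uniq_leq_size; first exact: fset_uniq.
  move=> p; rewrite in_fset_set; last exact: finite_chromatic_polynomials.
  by move=> /set_mem /fP[c <-]; apply: codom_f.
move/leq_trans; apply; rewrite size_codom card_ffun card_prod card_bool card_ord.
rewrite leq_pexp2l //; lia.
Qed.

End Upper.

(** * Spheres glued from triangles *)

Section Gluing.
Local Open Scope nat_scope.

(** Darts are natural numbers: the sides of the triangle number [t] are
    [3 * t], [3 * t + 1] and [3 * t + 2], in this cyclic order, and a list of
    pairs says which sides are glued. *)
Definition ends (M : seq (nat * nat)) : seq nat :=
  flatten [seq [:: p.1; p.2] | p <- M].

Fixpoint partner (M : seq (nat * nat)) x :=
  if M is (a, b) :: M' then
    if x == a then b else if x == b then a else partner M' x
  else x.

Lemma mem_ends M x :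
  reflect (exists y, (x, y) \in M \/ (y, x) \in M) (x \in ends M).
Proof.
apply: (iffP flatten_mapP) => [[[a b] Mab]|[y [Mxy|Myx]]].
- by rewrite !inE => /orP[]/eqP->; [exists b; left | exists a; right].
- by exists (x, y) => //; rewrite inE eqxx.
- by exists (y, x) => //; rewrite !inE eqxx orbT.
Qed.

Lemma partnerP M x y : uniq (ends M) -> (x, y) \in M ->
  [/\ partner M x = y, partner M y = x & x != y].
Proof.
elim: M => // -[a b] M IHM /=; rewrite -/(ends M) !inE negb_or.
case/and3P => /andP[ab aM] bM uM /orP[/eqP[-> ->]|Mxy].
  by rewrite !eqxx eq_sym (negPf ab).
have xM : x \in ends M by apply/mem_ends; exists y; left.
have yM : y \in ends M by apply/mem_ends; exists x; right.
have [-> -> ->] := IHM uM Mxy.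
by do !case: eqP => [E|_]; first [by rewrite -E ?xM ?yM in aM bM | split].
Qed.

Lemma exists_matching M q : perm_eq (ends M) (iota 0 q) ->
  exists2 e : 'I_q -> 'I_q, involutive e /\ forall x, e x != x &
    (forall x : 'I_q, exists y : 'I_q, e x = y /\
       ((val x, val y) \in M \/ (val y, val x) \in M)) /\
    (forall x y : 'I_q, (val x, val y) \in M -> e x = y).
Proof.
move=> ME; have uM : uniq (ends M) by rewrite (perm_uniq ME) iota_uniq.
have memM x : (x \in ends M) = (x < q) by rewrite (perm_mem ME) mem_iota.
have partM x : x < q -> [/\ partner M x < q, partner M (partner M x) = x,
    partner M x != x & (x, partner M x) \in M \/ (partner M x, x) \in M].
  rewrite -memM => /mem_ends[y [Mxy|Myx]].
    have [-> -> ne] := partnerP uM Mxy; split=> //; last 2 first.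
    - by rewrite eq_sym.
    - by left.
    by rewrite -memM; apply/mem_ends; exists x; right.
  have [Ey Ex ne] := partnerP uM Myx; rewrite Ex Ey; split=> //.
    by rewrite -memM; apply/mem_ends; exists x; left.
  by right.
have lt (x : 'I_q) : partner M x < q by case: (partM x (ltn_ord x)).
exists (fun x => Ordinal (lt x)); split.
- by move=> x; apply: val_inj; case: (partM x (ltn_ord x)).
- by move=> x; rewrite -val_eqE; case: (partM x (ltn_ord x)).
- by move=> x; exists (Ordinal (lt x)); split=> //; case: (partM x (ltn_ord x)).
- by move=> x y /(partnerP uM)[Ey _ _]; apply: val_inj.
Qed.

Definition turn x := if x %% 3 == 2 then x - 2 else x.+1.

Lemma turnS x : x %% 3 != 2 -> turn x = x.+1.
Proof. by rewrite /turn => /negPf->. Qed.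

Lemma turnB x : x %% 3 = 2 -> turn x = x - 2.
Proof. by rewrite /turn => ->. Qed.

Lemma turn_turn x : turn (turn (turn x)) = x.
Proof.
have [E|[E|E]] : x %% 3 = 0 \/ x %% 3 = 1 \/ x %% 3 = 2 by lia.
- by rewrite (turnS (x := x)) ?(turnS (x := x.+1)) ?(turnB (x := x.+2)); lia.
- by rewrite (turnS (x := x)) ?(turnB (x := x.+1)) ?(turnS (x := x.+1 - 2)); lia.
- by rewrite (turnB (x := x)) ?(turnS (x := x - 2)) ?(turnS (x := (x - 2).+1)); lia.
Qed.

Lemma turn_neq x : turn x != x.
Proof. by rewrite /turn; case: ifP; lia. Qed.

Lemma turn_lt q x : 3 %| q -> x < q -> turn x < q.
Proof. by rewrite /turn; case: eqP; lia. Qed.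

(** The entry of [L] at a dart is the label of its origin, so the dart [x] joins
    the labels at [x] and at [turn x]. *)
Definition rainbow (L : seq nat) (K : eqType) (g : nat -> K) :=
  all (fun x => g (nth 0 L x) != g (nth 0 L (turn x))) (iota 0 (size L)).

(** A connected oriented surface glued from triangles, where [B] lists the
    sides left unglued; connectedness is expressed by propagation from the
    dart 0. *)
Record triangulated (M : seq (nat * nat)) (L B : seq nat) n : Prop := Triangulated {
  glued_once : perm_eq (ends M ++ B) (iota 0 (size L));
  labels_glued : forall x y, (x, y) \in M ->
    nth 0 L x = nth 0 L (turn y) /\ nth 0 L (turn x) = nth 0 L y;
  labels_onto : forall v, (v \in L) = (v < n);
  glued_connected : forall P : pred nat,
    (forall x, x < size L -> P x -> P (turn x)) ->
    (forall x y, (x, y) \in M -> P x = P y) ->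
    P 0 -> forall x, x < size L -> P x
}.

Lemma card_porbit_order3 (D : finType) (s : {perm D}) x :
  s (s (s x)) = x -> s x != x -> #|porbit s x| = 3.
Proof.
move=> s3 s1; have := uniq_traject_porbit s x; have := iter_porbit s x.
have := card_porbit_neq0 s x.
case: #|_| => [|[|[|[|c]]]] //= _.
- by move/eqP; rewrite (negPf s1).
- by move=> s2; move: s3 s1; rewrite s2 => ->; rewrite eqxx.
- by move=> _; rewrite s3 !inE eqxx !orbT.
Qed.

(** The Euler inequality bounds the number of vertices by [n], which is also
    the number of labels; a labelling that is constant around vertices and
    takes [n] values therefore separates them, and sphericity comes for free. *)
Theorem triangulated_sphere M L n :
  triangulated M L [::] n -> size L = 6 * (n - 2) -> 2 < n ->
  exists G : rotation_system, [/\ planar_triangulation G, #|vertex G| = n &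
    forall k, #|proper_colorings G k.+1| =
      #|[set t : n.-tuple 'I_k.+1 | rainbow L (nth ord0 t)]|].
Proof.
case; rewrite cats0 => glued labM labL conn sizeL n2.
set q := size L in glued conn sizeL.
have q3 : 3 %| q by rewrite sizeL; lia.
have [e [eK e_neq] [eM Me]] := exists_matching glued.
pose tu (x : 'I_q) := Ordinal (turn_lt q3 (ltn_ord x)).
have tu3 x : tu (tu (tu x)) = x by apply: val_inj; rewrite /= turn_turn.
have tu_inj : injective tu by apply: (can_inj (g := tu \o tu)) => x /=.
pose ep := perm (inv_inj eK); pose fp := perm tu_inj.
have epK x : ep (ep x) = x by rewrite !permE eK.
have ep_neq x : ep x != x by rewrite permE.
pose G := RotationSystem (ep * fp)%g epK ep_neq.
have nodeE x : node G x = tu (e x) by rewrite permM !permE.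
have faceE x : face G x = tu x by rewrite /face permM nodeE !permE eK.
have edgeE x : edge G x = e x by rewrite permE.
have lab_lt (x : 'I_q) : nth 0 L x < n by rewrite -labL mem_nth.
pose lab (x : dart G) : 'I_n := Ordinal (lab_lt x).
have lab_node x : lab (node G x) = lab x.
  apply: val_inj; rewrite nodeE /=.
  by have [y [-> [/labM[]|/labM[]]]] := eM x.
have lab_face x : lab (edge G x) = lab (face G x).
  by rewrite /face permM lab_node.
have lab_surj v : exists x, lab x = v.
  have Lv : val v \in L by rewrite labL; apply: ltn_ord.
  have ltv : index (val v) L < q by rewrite index_mem.
  by exists (Ordinal ltv); apply: val_inj; rewrite /= nth_index.
have lab_origin x y : origin x = origin y -> lab x = lab y.
  move/eqP; rewrite origin_eq; exact: porbit_invariant.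
pose dl v := sval (sig_eqW (lab_surj v)).
have dlK v : lab (dl v) = v := svalP (sig_eqW (lab_surj v)).
have dl_inj : injective (fun v => origin (dl v)).
  by move=> u v /lab_origin; rewrite !dlK.
have tri x : #|porbit (face G) x| = 3.
  by apply: card_porbit_order3; rewrite !faceE // -val_eqE turn_neq.
have q0 : 0 < q by lia.
pose x0 : dart G := Ordinal q0.
have adj_step x : connect (@adjacent G) (origin x) (origin (edge G x)).
  by apply: connect1; apply/existsP; exists x; rewrite !eqxx.
have adj_sym x : connect (@adjacent G) (origin (edge G x)) (origin x).
  by have := adj_step (edge G x); rewrite edgeK.
have connG : connected_graph G.
  have conn0 x : connect (@adjacent G) (origin x0) (origin x)
               /\ connect (@adjacent G) (origin x) (origin x0).
    pose Q (x : dart G) := connect (@adjacent G) (origin x0) (origin x)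
      && connect (@adjacent G) (origin x) (origin x0).
    have QE y : Q (edge G y) = Q y.
      have step z : Q z -> Q (edge G z).
        move=> /andP[c1 c2]; apply/andP; split.
          exact: connect_trans (adj_step z).
        exact: connect_trans (adj_sym z) _.
      by apply/idP/idP => /step //; rewrite edgeK.
    apply/andP; rewrite -/(Q x).
    pose P i := if insub i is Some y then Q y else false.
    have PE (y : 'I_q) : P (val y) = Q y by rewrite /P valK.
    rewrite -PE; apply: (conn P _ _ _ (val x) (ltn_ord x)) => [i ltq|i j Mij|].
    - have -> : i = val (Ordinal ltq) by [].
      rewrite -[turn _]/(val (tu (Ordinal ltq))) !PE -faceE /face permM.
      by rewrite /Q origin_node -!/(Q _) QE.
    - have iq : i < q.
        have : i \in ends M by apply/mem_ends; exists j; left.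
        by rewrite (perm_mem glued) mem_iota.
      have jq : j < q.
        have : j \in ends M by apply/mem_ends; exists i; right.
        by rewrite (perm_mem glued) mem_iota.
      have := Me (Ordinal iq) (Ordinal jq) Mij.
      rewrite -edgeE => Ej; have := QE (Ordinal iq).
      by rewrite Ej -!PE /= => ->.
    - by rewrite -[0]/(val x0) PE /Q connect0.
  move=> u v; have [x <-] := origin_surj u; have [y <-] := origin_surj v.
  exact: connect_trans (conn0 x).2 (conn0 y).1.
have cardq : #|dart G| = q by rewrite card_ord.
have cardV : #|vertex G| = n.
  apply/eqP; rewrite eqn_leq; apply/andP; split.
    have := euler_inequality (@edgeK G) (@edge_neq G) x0 (connected_transitive connG).
    have := card_porbits_const tri; rewrite cardq card_vertex.
    by rewrite -/(face G) sizeL; lia.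
  by rewrite -[n]card_ord; apply: leq_card dl_inj.
have labP x y : (lab x == lab y) = (origin x == origin y).
  apply/eqP/eqP => [|/lab_origin //].
  have [j jK Kj] : bijective (fun v => origin (dl v)).
    by apply: inj_card_bij; rewrite // card_ord cardV.
  rewrite -[origin x]Kj -[origin y]Kj.
  have labj z : lab z = j (origin z).
    by rewrite -[RHS]dlK; apply: lab_origin; rewrite Kj.
  by rewrite !labj => ->.
exists G; split=> //.
  split=> //; rewrite /spherical cardV.
  have := card_porbits_const tri.
  have := card_porbits_const (card_edge_porbit (G := G)).
  by rewrite /norbits cardq sizeL; lia.
move=> k; rewrite (card_proper_colorings _ lab_surj labP).
pose F (t : n.-tuple 'I_k.+1) := [ffun v : 'I_n => tnth t v].
have F_inj : injective F.
  by move=> t u /ffunP E; apply: eq_from_tnth => v; have := E v; rewrite !ffunE.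
rewrite -[RHS](card_imset _ F_inj); apply: eq_card => g; rewrite inE.
have Fmk : F [tuple g i | i < n] = g.
  by apply/ffunP => v; rewrite ffunE tnth_mktuple.
rewrite -Fmk (mem_imset _ _ F_inj) inE.
set t := mktuple _; apply/forallP/allP => ok.
  move=> i; rewrite mem_iota add0n => /andP[_ ltq].
  have := ok (Ordinal ltq); rewrite lab_face faceE !ffunE !(tnth_nth ord0) /=.
  by [].
move=> x; rewrite lab_face faceE !ffunE !(tnth_nth ord0) /=.
by apply: ok; rewrite mem_iota add0n ltn_ord.
Qed.

End Gluing.

(** * A family of triangulated discs *)

Section Discs.
Local Open Scope nat_scope.

(** A disc whose boundary is the square with corners labelled 0 and 1 (the
    corners a and b, which never move), [vc] and [vd]; the side from a to b is
    always the dart 0. *)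
Record disc := Disc {
  gluing : seq (nat * nat);
  labels : seq nat;
  nvert : nat;
  vc : nat; vd : nat;
  side_bc : nat; side_cd : nat; side_da : nat
}.

Definition disc0 :=
  Disc [:: (1, 5)] [:: 0; 1; 3; 1; 2; 3] 4 2 3 3 4 2.

(** Two triangles are glued on consecutive sides of the square and on each
    other, which covers the corner d ([b] true) or c ([b] false) and creates
    the new corner [n]. *)
Definition extend (b : bool) (D : disc) :=
  let: Disc M L n c d sb sc sd := D in
  let q := size L in
  if b then
    Disc (M ++ [:: (sc, q); (sd, q + 3); (q + 2, q + 4)])
         (L ++ [:: d; c; n; 0; d; n]) n.+1 c n sb (q + 1) (q + 5)
  else
    Disc (M ++ [:: (sb, q); (sc, q + 3); (q + 2, q + 4)])
         (L ++ [:: c; 1; n; d; c; n]) n.+1 n d (q + 1) (q + 5) sd.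

Definition disc_of (w : seq bool) := foldr extend disc0 w.

(** The outside of the square, cut along the diagonal a c. *)
Definition outer_gluing D := let q := size (labels D) in
  gluing D ++ [:: (side_bc D, q); (0, q + 1); (side_da D, q + 3);
                  (side_cd D, q + 4); (q + 2, q + 5)].

Definition outer_labels D :=
  labels D ++ [:: vc D; 1; 0; 0; vd D; vc D].

Definition boundary D := [:: 0; side_bc D; side_cd D; side_da D].

Definition dart_joins (L : seq nat) x u v :=
  [/\ x < size L, nth 0 L x = u & nth 0 L (turn x) = v].

Record disc_ok (D : disc) : Prop := DiscOk {
  disc_tri : triangulated (gluing D) (labels D) (boundary D) (nvert D);
  disc_size : size (labels D) + 18 = 6 * nvert D;
  joins_ab : dart_joins (labels D) 0 0 1;
  joins_bc : dart_joins (labels D) (side_bc D) 1 (vc D);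
  joins_cd : dart_joins (labels D) (side_cd D) (vc D) (vd D);
  joins_da : dart_joins (labels D) (side_da D) (vd D) 0
}.

Lemma dart_joins_cat L T x u v :
  3 %| size L -> dart_joins L x u v -> dart_joins (L ++ T) x u v.
Proof.
move=> L3 [ltx <- <-]; split; first by rewrite size_cat ltn_addr.
  by rewrite nth_cat ltx.
by rewrite nth_cat turn_lt.
Qed.

Lemma dart_joins_new L T j u v :
  3 %| size L -> dart_joins T j u v -> dart_joins (L ++ T) (size L + j) u v.
Proof.
move=> L3 [ltj <- <-]; split; first by rewrite size_cat ltn_add2l.
  by rewrite nth_cat ltnNge leq_addr /= addKn.
have -> : turn (size L + j) = size L + turn j by rewrite /turn; do !case: ifP; lia.
by rewrite nth_cat ltnNge leq_addr /= addKn.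
Qed.

Lemma ends_cat M N : ends (M ++ N) = ends M ++ ends N.
Proof. by rewrite /ends map_cat flatten_cat. Qed.

(** Gluing the triangles of [T]: each of them has a side attached to the old part,
    which keeps the surface connected. *)
Lemma triangulated_glue M L B n N T B' n' :
  3 %| size L ->
  triangulated M L B n ->
  perm_eq (ends N ++ B') (B ++ iota (size L) (size T)) ->
  (forall x y, (x, y) \in N -> exists u v,
     dart_joins (L ++ T) x u v /\ dart_joins (L ++ T) y v u) ->
  (forall v, (v < n') = (v < n) || (v \in T)) ->
  0 < size L ->
  (forall x, x < size T -> exists2 y, (y, size L + x) \in N \/
     (y, size L + turn x) \in N \/ (y, size L + turn (turn x)) \in N & y < size L) ->
  3 %| size T ->
  triangulated (M ++ N) (L ++ T) B' n'.
Proof.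
move=> L3 [glued labM labL conn] permN labN labT L0 attached T3; split.
- rewrite ends_cat -catA size_cat iotaD add0n.
  rewrite -(perm_cat2l (ends M)) in permN; rewrite (permPl permN) catA perm_cat2r.
  exact: glued.
- have ltM x y : (x, y) \in M -> x < size L /\ y < size L.
    move=> Mxy; have inM z : z \in ends M -> z < size L.
      move=> Mz; have : z \in ends M ++ B by rewrite mem_cat Mz.
      by rewrite (perm_mem glued) mem_iota.
    by split; apply: inM; apply/mem_ends; [exists y; left | exists x; right].
  move=> x y; rewrite mem_cat => /orP[Mxy|/labN[u [v [[_ -> ->] [_ -> ->]]]] //].
  have [ltx lty] := ltM x y Mxy; rewrite !nth_cat ltx lty !turn_lt //.
  exact: labM.
- by move=> v; rewrite mem_cat labL labT.
move=> P Pt Pg P0.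
have PL x : x < size L -> P x.
  apply: conn => // [y lty|y z Myz]; last by apply: Pg; rewrite mem_cat Myz.
  by apply: Pt; rewrite size_cat ltn_addr.
move=> x; rewrite size_cat; have [ltx|geL] := ltnP x (size L); first by move=> _; apply: PL.
rewrite -[x](subnKC geL) ltn_add2l; move: (x - _) => {geL}j ltj.
have turnL i : size L + turn i = turn (size L + i).
  by rewrite /turn; do !case: ifP; lia.
have Pt3 i : i < size T -> P (size L + turn i) -> P (size L + i).
  have Pstep j' : j' < size T -> P (size L + j') -> P (size L + turn j').
    by move=> ltj'; rewrite turnL; apply: Pt; rewrite size_cat ltn_add2l.
  by move=> lti Pi; rewrite -[i]turn_turn; apply: (Pstep); rewrite ?turn_lt //; apply: Pstep; rewrite ?turn_lt.
have Ptm i : i < size T -> turn i < size T by apply: turn_lt.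
have [y Ny lty] := attached j ltj.
have PN i : (y, i) \in N -> P i.
  by move=> Nyi; rewrite -(Pg y i) ?PL // mem_cat Nyi orbT.
case: Ny => [/PN//|[/PN|/PN]]; first exact: Pt3.
by move=> P2; do 2!(apply: (Pt3) => //); apply: Ptm.
Qed.

Lemma disc0_ok : disc_ok disc0.
Proof.
split; try by []; split=> //.
- by move=> x y; rewrite inE => /eqP[-> ->].
- by move=> v; do 4?[case: v => [|v] //].
move=> P Pt Pg P0.
have P1 : P 1 by exact: (Pt 0).
have P2 : P 2 by exact: (Pt 1).
have P5 : P 5 by rewrite -(Pg 1 5).
have P3 : P 3 by exact: (Pt 5).
have P4 : P 4 by exact: (Pt 3).
by do 6?[case=> [|] //].
Qed.

Lemma size_labels_dvd D : disc_ok D -> (3 %| size (labels D)) && (0 < size (labels D)).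
Proof.
by move=> ok; have [] := joins_ab ok; have := disc_size ok; lia.
Qed.

Lemma lab_lt_nvert D x u v :
  disc_ok D -> dart_joins (labels D) x u v -> u < nvert D.
Proof.
by move=> ok [lt <- _]; rewrite -(labels_onto (disc_tri ok)) mem_nth.
Qed.

(** The darts 0, 1, 2 belong to one new triangle and 3, 4, 5 to the other; it
    is enough to attach one side of each. *)
Lemma attach_pair (P : nat -> nat -> Prop) x s t : x < 6 ->
  (P s 0) -> (P t 3) ->
  exists2 y, P y x \/ (P y (turn x) \/ P y (turn (turn x))) & y = s \/ y = t.
Proof.
move=> ltx Ps Pt; have [x3|x3] := ltnP x 3.
  exists s; last by left.
  by case: x ltx x3 => [|[|[|x]]] //= _ _; rewrite /turn /=; tauto.
exists t; last by right.
by case: x ltx x3 => [|[|[|[|[|[|x]]]]]] //= _ _; rewrite /turn /=; tauto.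
Qed.

Lemma extend_ok b D : disc_ok D -> disc_ok (extend b D).
Proof.
move=> ok; have /andP[L3 L0] := size_labels_dvd ok.
have a0 := lab_lt_nvert ok (joins_ab ok).
have b1 := lab_lt_nvert ok (joins_bc ok).
have c1 := lab_lt_nvert ok (joins_cd ok).
have d1 := lab_lt_nvert ok (joins_da ok).
have := disc_size ok; have := joins_ab ok; have := joins_bc ok.
have := joins_cd ok; have := joins_da ok; have := disc_tri ok.
case: D ok L3 L0 a0 b1 c1 d1 => M L n c d sb sc sd ok L3 L0 a0 b1 c1 d1.
rewrite /boundary /= in L3 L0 a0 b1 c1 d1 * => tri jda jcd jbc jab szL.
have old T x u v := @dart_joins_cat L T x u v L3.
have new T j u v := @dart_joins_new L T j u v L3.
have new0 T u v : dart_joins T 0 u v -> dart_joins (L ++ T) (size L) u v.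
  by move/(new T 0); rewrite addn0.
case: b; split=> /=; rewrite ?size_cat /=; try lia;
  try by [apply: old | apply: new].
  apply: (triangulated_glue L3 tri) => //=.
  - by apply/seq.permP => P /=; rewrite !addnS !addn0; lia.
  - move=> x y; rewrite !inE => /or3P[] /eqP[-> ->].
    + by exists c, d; split; [apply: old | apply: new0].
    + by exists d, 0; split; [apply: old | apply: new].
    + by exists n, d; split; apply: new.
  - by move=> v; rewrite !inE; lia.
  - move=> x ltx.
    have [||y Py ey] := @attach_pair (fun y i => (y, size L + i) \in
      [:: (sc, size L); (sd, size L + 3); (size L + 2, size L + 4)]) x sc sd ltx.
    + by rewrite addn0 !inE eqxx.
    + by rewrite !inE eqxx orbT.
    by exists y => //; case: ey => ->; [case: jcd | case: jda].
apply: (triangulated_glue L3 tri) => //=.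
- by apply/seq.permP => P /=; rewrite !addnS !addn0; lia.
- move=> x y; rewrite !inE => /or3P[] /eqP[-> ->].
  + by exists 1, c; split; [apply: old | apply: new0].
  + by exists c, d; split; [apply: old | apply: new].
  + by exists n, c; split; apply: new.
- by move=> v; rewrite !inE; lia.
- move=> x ltx.
  have [||y Py ey] := @attach_pair (fun y i => (y, size L + i) \in
    [:: (sb, size L); (sc, size L + 3); (size L + 2, size L + 4)]) x sb sc ltx.
  + by rewrite addn0 !inE eqxx.
  + by rewrite !inE eqxx orbT.
  by exists y => //; case: ey => ->; [case: jbc | case: jcd].
Qed.

Lemma disc_of_ok w : disc_ok (disc_of w).
Proof. elim: w => [|b w IHw]; [exact: disc0_ok | exact: extend_ok]. Qed.

Lemma outer_triangulated D : disc_ok D ->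
  triangulated (outer_gluing D) (outer_labels D) [::] (nvert D).
Proof.
move=> ok; have /andP[L3 L0] := size_labels_dvd ok.
have a0 := lab_lt_nvert ok (joins_ab ok).
have b1 := lab_lt_nvert ok (joins_bc ok).
have c1 := lab_lt_nvert ok (joins_cd ok).
have d1 := lab_lt_nvert ok (joins_da ok).
have := disc_size ok; have := joins_ab ok; have := joins_bc ok.
have := joins_cd ok; have := joins_da ok; have := disc_tri ok.
rewrite /outer_gluing /outer_labels.
case: D ok L3 L0 a0 b1 c1 d1 => M L n c d sb sc sd ok L3 L0 a0 b1 c1 d1.
rewrite /boundary /= in L3 L0 a0 b1 c1 d1 * => tri jda jcd jbc jab szL.
have old T x u v := @dart_joins_cat L T x u v L3.
have new T j u v := @dart_joins_new L T j u v L3.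
have new0 T u v : dart_joins T 0 u v -> dart_joins (L ++ T) (size L) u v.
  by move/(new T 0); rewrite addn0.
apply: (triangulated_glue L3 tri) => //=.
- by apply/seq.permP => P /=; rewrite !addnS !addn0; lia.
- move=> x y; rewrite !inE.
  case/orP=> [|/or4P[]] /eqP[-> ->].
  + by exists 1, c; split; [apply: old | apply: new0].
  + by exists 0, 1; split; [apply: old | apply: new].
  + by exists d, 0; split; [apply: old | apply: new].
  + by exists c, d; split; [apply: old | apply: new].
  + by exists 0, c; split; apply: new.
- by move=> v; rewrite !inE; lia.
- move=> x ltx.
  have [||y Py ey] := @attach_pair (fun y i => (y, size L + i) \in
    [:: (sb, size L); (0, size L + 1); (sd, size L + 3); (sc, size L + 4);
        (size L + 2, size L + 5)]) x sb sd ltx.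
  + by rewrite addn0 !inE eqxx.
  + by rewrite !inE eqxx !orbT.
  by exists y => //; case: ey => ->; [case: jbc | case: jda].
Qed.

Lemma nvert_disc_of w : nvert (disc_of w) = 4 + size w.
Proof.
by elim: w => //= b w; case: (disc_of w) b => M L n c d sb sc sd [] /= ->.
Qed.

Lemma disc_sphere w :
  exists G : rotation_system, [/\ planar_triangulation G,
    #|vertex G| = nvert (disc_of w) &
    forall k, #|proper_colorings G k.+1| =
      #|[set t : (nvert (disc_of w)).-tuple 'I_k.+1 |
          rainbow (outer_labels (disc_of w)) (nth ord0 t)]|].
Proof.
have ok := disc_of_ok w; apply: triangulated_sphere (outer_triangulated ok) _ _.
  by have := disc_size ok; rewrite /outer_labels size_cat /=; lia.
by rewrite nvert_disc_of.
Qed.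

End Discs.

(** * Counting the colourings of the discs *)

Section Rainbow.

Definition distinct3 (K : eqType) (a b c : K) := [&& a != b, b != c & c != a].

Lemma rainbow_cat (L T : seq nat) (K : eqType) (g : nat -> K) :
  (3 %| size L)%N -> (3 %| size T)%N ->
  rainbow (L ++ T) g = rainbow L g && rainbow T g.
Proof.
move=> L3 T3; rewrite /rainbow size_cat iotaD all_cat add0n; congr (_ && _).
  apply: eq_in_all => x; rewrite mem_iota add0n => /andP[_ ltx].
  by rewrite !nth_cat turn_lt // ltx.
have -> : iota (size L) (size T) = map (addn (size L)) (iota 0 (size T)).
  by rewrite -iotaDl addn0.
rewrite all_map; apply: eq_in_all => x _ /=.
have -> : turn (size L + x) = (size L + turn x)%N.
  by rewrite /turn; do !case: ifP; lia.
by rewrite !nth_cat !ltnNge !leq_addr /= !addKn.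
Qed.

Lemma eq_rainbow (L : seq nat) (K : eqType) (g h : nat -> K) :
  (3 %| size L)%N -> {in L, g =1 h} -> rainbow L g = rainbow L h.
Proof.
move=> L3 gh; apply: eq_in_all => x; rewrite mem_iota add0n => /andP[_ ltx].
by rewrite !gh ?mem_nth ?turn_lt.
Qed.

Lemma rainbow_pair (a b c d e f : nat) (K : eqType) (g : nat -> K) :
  rainbow [:: a; b; c; d; e; f] g = distinct3 (g a) (g b) (g c) && distinct3 (g d) (g e) (g f).
Proof. by rewrite /rainbow /distinct3 /= andbT -!andbA. Qed.

End Rainbow.

Section Weights.
Variables (R : comNzRingType) (q : R).

(** The numbers [x], [y], [z], [w] count the extensions to the disc of corner
    colours with a = c, b = d; a = c only; b = d only; neither.  A move
    covers one corner, over whose colour it sums. *)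
Definition extend_weights (b : bool) (v : R * R * R * R) : R * R * R * R :=
  let: (x, y, z, w) := v in
  if b then ((q - 2%:R) * y, x + (q - 3%:R) * y,
             (q - 3%:R) * w, z + (q - 4%:R) * w)
  else ((q - 2%:R) * z, (q - 3%:R) * w,
        x + (q - 3%:R) * z, y + (q - 4%:R) * w).

Definition weights (s : seq bool) := foldr extend_weights (0, 1, 0, 1) s.

End Weights.

Definition pattern (R : Type) (K : eqType) (v : R * R * R * R) (a b c d : K) : R :=
  let: (x, y, z, w) := v in
  if a == c then if b == d then x else y else if b == d then z else w.

Definition square_proper (K : eqType) (a b c d : K) :=
  [&& a != b, b != c, c != d & d != a].

Section Counting.
Variable k : nat.
Let K := 'I_k.+1.
Let q : int := k.+1%:R.

Lemma sum_indicator (R : pzSemiRingType) (F : K -> R) a :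
  \sum_d F d * (a == d)%:R = F a.
Proof.
rewrite (bigD1 a) //= eqxx mulr1 big1 ?addr0 // => d ne.
by rewrite eq_sym (negPf ne) mulr0.
Qed.

Lemma sum_outside (s : seq K) (F : K -> int) (r : int) : uniq s ->
  (forall d, d \notin s -> F d = r) ->
  \sum_d F d = \sum_(d <- s) F d + (q - (size s)%:R) * r.
Proof.
move=> us Fr; rewrite (bigID (mem s)) /= -big_uniq //; congr (_ + _).
rewrite (eq_bigr (fun=> r)) => [|d]; last exact: Fr.
rewrite sumr_const -[LHS]mulr_natl; congr (_ * _).
have := cardC (mem s); rewrite card_ord (card_uniqP us) => E.
have -> : q = (size s + #|[predC mem s]|)%N%:R by rewrite E.
by rewrite natrD addrC addKr; congr (_%:R); apply: eq_card.
Qed.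

(** Adding the corner d' joined to a, d, c.  The colour of the covered corner d
    must avoid those of a, c and d'; it contributes specially when it is the
    colour of b, and equally otherwise. *)
Lemma sum_new_corner v (a b c d' : K) :
  \sum_d (distinct3 d c d')%:R * (distinct3 a d d')%:R *
    ((square_proper a b c d)%:R * pattern v a b c d) =
  (square_proper a b c d')%:R * pattern (extend_weights q true v) a b c d'.
Proof.
case: v => [[[x y] z] w].
have [P|nP] := boolP (square_proper a b c d'); last first.
  rewrite mul0r big1 // => d _; move: nP; rewrite /square_proper /distinct3.
  rewrite !negb_and !negbK => /or4P[] /eqP->; rewrite !eqxx /=;
  by rewrite ?andbF /= ?mul0r ?mulr0 ?mul0r.
rewrite mul1r; move: P; rewrite /square_proper => /and4P[ab bc cd da].
pose F (d : K) := (distinct3 d c d')%:R * (distinct3 a d d')%:R *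
    ((square_proper a b c d)%:R * pattern (x, y, z, w) a b c d) : int.
rewrite -/(F) (_ : \sum_d _ = \sum_d F d) //.
have F0 d : d \in [:: a; c; d'] -> F d = 0.
  rewrite !inE /F /distinct3 /square_proper => /or3P[] /eqP->;
  by rewrite ?eqxx /= ?andbF ?mul0r ?mulr0 ?mul0r.
have F1 d : d \notin [:: a; c; d'] -> F d = pattern (x, y, z, w) a b c d.
  rewrite !inE !negb_or => /and3P[/negPf n1 /negPf n2 /negPf n3].
  rewrite /F /distinct3 /square_proper n1 n2 n3 ab bc (negPf da) (negPf cd).
  by rewrite !(eq_sym _ d) n1 n2 n3 /= !mul1r.
have pb : F b = if b == d' then 0 else if a == c then x else z.
  case: eqP => [->|/eqP bd]; first by apply: F0; rewrite !inE eqxx !orbT.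
  by rewrite F1 /= ?eqxx // !inE !negb_or bd eq_sym ab bc.
have other d : d \notin [:: a; c; b; d'] -> F d = if a == c then y else w.
  rewrite !inE !negb_or => /and4P[n1 n2 n3 n4].
  by rewrite F1 ?inE ?negb_or ?n1 ?n2 // /= (eq_sym b d) (negPf n3).
rewrite /=; have [Eac|nac] := eqVneq a c; have [Ebd|nbd] := eqVneq b d'.
- rewrite (@sum_outside [:: a; b] _ y).
  + by rewrite !big_cons big_nil pb -Ebd eqxx F0 ?inE ?eqxx //= !add0r.
  + by rewrite /= inE ab.
  + move=> d; rewrite !inE negb_or => /andP[n1 n2].
    by rewrite other ?Eac ?eqxx // !inE !negb_or -Eac -Ebd n1 n2.
- rewrite (@sum_outside [:: a; b; d'] _ y).
  + rewrite !big_cons big_nil pb (negPf nbd) Eac eqxx.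
    by rewrite !F0 ?inE ?Eac ?eqxx ?orbT //= add0r !addr0.
  + by rewrite /= !inE negb_or ab nbd (eq_sym a) da.
  + move=> d; rewrite !inE !negb_or => /and3P[n1 n2 n3].
    by rewrite other ?Eac ?eqxx // !inE !negb_or -Eac n1 n2 n3.
- rewrite (@sum_outside [:: a; c; b] _ w).
  + rewrite !big_cons big_nil pb Ebd eqxx.
    by rewrite !F0 ?inE ?eqxx ?orbT //= !add0r.
  + by rewrite /= !inE negb_or ab nac (eq_sym c) bc.
  + move=> d; rewrite !inE !negb_or => /and3P[n1 n2 n3].
    by rewrite other ?(negPf nac) // !inE !negb_or -Ebd n1 n2 n3.
- rewrite (@sum_outside [:: a; c; b; d'] _ w).
  + rewrite !big_cons big_nil pb (negPf nbd) (negPf nac).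
    by rewrite !F0 ?inE ?eqxx ?orbT //= !add0r !addr0.
  + by rewrite /= !inE !negb_or ab nac (eq_sym c) bc cd nbd (eq_sym a) da.
  + by move=> d ns; rewrite other // (negPf nac).
Qed.

(** The two outer triangles force a, b, c to be distinct and d to differ from a
    and c; then d takes the colour of b or one of [q - 3] others. *)
Lemma sum_closing v :
  \sum_(a : K) \sum_(c : K) \sum_(b : K) \sum_(d : K) (distinct3 c b a)%:R * (distinct3 a d c)%:R *
    ((square_proper a b c d)%:R * pattern v a b c d) =
  q * (q - 1) * (q - 2%:R) * (v.1.2 + (q - 3%:R) * v.2) :> int.
Proof.
case: v => [[[x y] z] w] /=; set r := z + _ * w.
pose F (a c b d : K) := (distinct3 c b a)%:R * (distinct3 a d c)%:R *
    ((square_proper a b c d)%:R * pattern (x, y, z, w) a b c d) : int.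
have S1 a c b : \sum_d F a c b d = (distinct3 c b a)%:R * r :> int.
  have [/and3P[cb ba ac]|nP] := boolP (distinct3 c b a); last first.
    rewrite mul0r big1 // => d _; by rewrite /F (negPf nP) !mul0r.
  have ca : c != a by rewrite eq_sym.
  have bc : b != c by rewrite eq_sym.
  have ab : a != b by rewrite eq_sym.
  rewrite (@sum_outside [:: a; c; b] _ w).
  + rewrite !big_cons big_nil /F /distinct3 /square_proper /pattern !eqxx /=.
    by rewrite ab bc ac ca ba cb (negPf ac) !andbF !andbT !mulr0 !mul0r !mul1r /r; ring.
  + by rewrite /= !inE negb_or ab ac cb.
  + move=> d; rewrite !inE !negb_or => /and3P[da dc db].
    rewrite /F /distinct3 /square_proper /pattern.
    by rewrite !(eq_sym _ d) ab bc ac ca ba cb da dc (negPf ac) (negPf db) !mul1r.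
have S2 a c : \sum_b \sum_d F a c b d = (a != c)%:R * ((q - 2%:R) * r) :> int.
  under eq_bigr do rewrite S1.
  have [E|nac] := eqVneq a c.
    by rewrite mul0r big1 // => b _; rewrite /distinct3 E eqxx !andbF mul0r.
  rewrite (@sum_outside [:: a; c] _ r).
  + by rewrite !big_cons big_nil /distinct3 !eqxx /= !andbF /= !mul0r !add0r mul1r.
  + by rewrite /= inE nac.
  + move=> b; rewrite !inE negb_or => /andP[n1 n2].
    by rewrite /distinct3 n1 nac eq_sym n2 mul1r.
have S3 a : \sum_c \sum_b \sum_d F a c b d = (q - 1) * ((q - 2%:R) * r) :> int.
  under eq_bigr do rewrite S2.
  rewrite (@sum_outside [:: a] _ ((q - 2%:R) * r)) //.
  + by rewrite big_seq1 eqxx mul0r add0r.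
  + by move=> c; rewrite inE eq_sym => ->; rewrite mul1r.
transitivity (\sum_(a : K) \sum_c \sum_b \sum_d F a c b d) => //.
under eq_bigr do rewrite S3.
by rewrite sumr_const card_ord -mulr_natl /q; ring.
Qed.

Lemma sum_rcons_tuple n (F : n.+1.-tuple K -> int) :
  \sum_t F t = \sum_(t : n.-tuple K) \sum_e F [tuple of rcons t e].
Proof.
rewrite pair_big /=.
have bij : bijective (fun p : n.-tuple K * K => [tuple of rcons p.1 p.2]).
  apply: inj_card_bij; last by rewrite card_prod !card_tuple expnS mulnC.
  by move=> [t e] [u f] /(congr1 val) /= /rcons_inj[/val_inj -> ->].
by rewrite (reindex _ (onW_bij _ bij)).
Qed.

Definition col n (t : n.-tuple K) v : K := nth ord0 t v.

Definition disc_colorings (D : disc) (a b c d : K) : int :=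
  \sum_(t : (nvert D).-tuple K) (rainbow (labels D) (col t))%:R *
    (col t 0 == a)%:R * (col t 1 == b)%:R *
    (col t (vc D) == c)%:R * (col t (vd D) == d)%:R.

Lemma disc0_colorings a b c d :
  disc_colorings disc0 a b c d =
  (square_proper a b c d)%:R * pattern (0, 1, 0, 1) a b c d.
Proof.
rewrite /disc_colorings (bigD1 [tuple a; b; c; d]) //= big1 => [|t]; last first.
  case: t => [[|t0 [|t1 [|t2 [|t3 []]]]] //] i; rewrite /col -val_eqE /= => ne.
  move: ne; rewrite !eqseq_cons andbT; do !case: eqP => //= _; rewrite ?mulr0 //.
rewrite addr0 /col /= !eqxx !mulr1 rainbow_pair /distinct3 /square_proper /=.
do !case: eqP => //= *; subst; try congruence.
Qed.

Lemma col_rcons n (t : n.-tuple K) e v : (v < n)%N ->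
  col [tuple of rcons t e] v = col t v.
Proof. by move=> ltv; rewrite /col nth_rcons size_tuple ltv. Qed.

Lemma col_rcons_last n (t : n.-tuple K) e : col [tuple of rcons t e] n = e.
Proof. by rewrite /col nth_rcons size_tuple ltnn eqxx. Qed.

(** The label of the new corner is the number of old labels, so a colouring of
    the bigger disc appends one colour to a colouring of the old one. *)
Lemma extend_colorings w (s : seq bool) a b c d :
  disc_colorings (disc_of (w :: s)) a b c d =
  if w then \sum_e (distinct3 e c d)%:R * (distinct3 a e d)%:R *
              disc_colorings (disc_of s) a b c e
  else \sum_e (distinct3 e b c)%:R * (distinct3 d e c)%:R *
              disc_colorings (disc_of s) a b e d.
Proof.
have ok := disc_of_ok s; have /andP[L3 _] := size_labels_dvd ok.
have a0 := lab_lt_nvert ok (joins_ab ok).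
have b1 := lab_lt_nvert ok (joins_bc ok).
have c1 := lab_lt_nvert ok (joins_cd ok).
have d1 := lab_lt_nvert ok (joins_da ok).
have labn := labels_onto (disc_tri ok).
rewrite /disc_of /= -/(disc_of s).
case: (disc_of s) ok L3 a0 b1 c1 d1 labn => M L n vc vd sb sc sd ok L3 a0 b1 c1 d1 labn.
rewrite /disc_colorings /= in L3 a0 b1 c1 d1 labn *.
have oldL (t : n.-tuple K) e : rainbow L (col [tuple of rcons t e]) = rainbow L (col t).
  by apply: eq_rainbow => // v Lv; rewrite col_rcons // -labn.
case: w; rewrite sum_rcons_tuple /=.
- under [RHS]eq_bigr do rewrite mulr_sumr.
  rewrite [RHS]exchange_big /=; apply: eq_bigr => t _.
  under eq_bigr => e _.
    rewrite rainbow_cat // oldL rainbow_pair col_rcons_last.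
    rewrite !(col_rcons _ _ a0, col_rcons _ _ b1, col_rcons _ _ c1, col_rcons _ _ d1).
    rewrite (eq_sym e d); over.
  rewrite sum_indicator.
  under [RHS]eq_bigr do rewrite !mulrA.
  rewrite sum_indicator.
  have [<-|_] := eqVneq (col t 0) a; last by rewrite !(mulr0, mul0r).
  have [<-|_] := eqVneq (col t vc) c; last by rewrite !(mulr0, mul0r).
  by rewrite !mulr1; case: rainbow; do !case: (distinct3 _ _ _); rewrite /= ?(mulr1, mul1r, mulr0, mul0r).
- under [RHS]eq_bigr do rewrite mulr_sumr.
  rewrite [RHS]exchange_big /=; apply: eq_bigr => t _.
  under eq_bigr => e _.
    rewrite rainbow_cat // oldL rainbow_pair col_rcons_last.
    rewrite !(col_rcons _ _ a0, col_rcons _ _ b1, col_rcons _ _ c1, col_rcons _ _ d1).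
    rewrite (eq_sym e c) mulrAC; over.
  rewrite sum_indicator.
  under [RHS]eq_bigr do rewrite !mulrA mulrAC.
  rewrite sum_indicator.
  have [<-|_] := eqVneq (col t 1) b; last by rewrite !(mulr0, mul0r).
  have [<-|_] := eqVneq (col t vd) d; last by rewrite !(mulr0, mul0r).
  by rewrite !mulr1; case: rainbow; do !case: (distinct3 _ _ _); rewrite /= ?(mulr1, mul1r, mulr0, mul0r).
Qed.

Lemma disc_coloringsE s a b c d :
  disc_colorings (disc_of s) a b c d =
  (square_proper a b c d)%:R * pattern (weights q s) a b c d.
Proof.
elim: s a b c d => [|w s IHs] a b c d; first exact: disc0_colorings.
rewrite extend_colorings; case: w.
  by under eq_bigr do rewrite IHs; rewrite sum_new_corner.
have rot (e : K) : square_proper a b e d = square_proper d a b e.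
  by rewrite /square_proper; do !case: (_ != _).
under eq_bigr => e _.
  rewrite IHs.
  have -> : (square_proper a b e d)%:R * pattern (weights q s) a b e d =
    (square_proper d a b e)%:R *
    pattern (let: (x, y, z, w) := weights q s in (x, z, y, w)) d a b e :> int.
    rewrite rot /pattern; case: (weights q s) => [[[x y] z] w].
    by rewrite (eq_sym d b); case: eqP; case: eqP.
  over.
rewrite sum_new_corner rot /pattern /=; case: (weights q s) => [[[x y] z] w] /=.
by rewrite (eq_sym d b); case: eqP; case: eqP.
Qed.

Lemma closed_colorings s :
  #|[set t : (nvert (disc_of s)).-tuple 'I_k.+1 |
      rainbow (outer_labels (disc_of s)) (nth ord0 t)]|%:R =
  q * (q - 1) * (q - 2%:R) * ((weights q s).1.2 + (q - 3%:R) * (weights q s).2) :> int.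
Proof.
have ok := disc_of_ok s; have /andP[L3 _] := size_labels_dvd ok.
rewrite -sum_closing.
transitivity (\sum_(a : K) \sum_(c : K) \sum_(b : K) \sum_(d : K) (distinct3 c b a)%:R * (distinct3 a d c)%:R *
    disc_colorings (disc_of s) a b c d).
  rewrite -sum1_card natr_sum big_mkcond /=.
  under [RHS]eq_bigr => a _.
    under eq_bigr => c _.
      under eq_bigr => b _.
        under eq_bigr do rewrite mulr_sumr.
        rewrite exchange_big; over.
      rewrite exchange_big; over.
    rewrite exchange_big; over.
  rewrite [RHS]exchange_big /=; apply: eq_bigr => t _.
  set A := rainbow (labels (disc_of s)) (col t).
  under [RHS]eq_bigr => a _.
    under eq_bigr => c _.
      under eq_bigr => b _.
        under eq_bigr do rewrite !mulrA.
        rewrite sum_indicator mulrAC; over.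
      rewrite sum_indicator; over.
    rewrite sum_indicator; over.
  rewrite sum_indicator inE /outer_labels rainbow_cat // rainbow_pair -/A.
  by case: A; do !case: (distinct3 _ _ _); rewrite /= ?(mulr1, mul1r, mulr0, mul0r).
by do 4!(apply: eq_bigr => ? _); rewrite disc_coloringsE.
Qed.
End Counting.

(** * Entry sums in the Stern-Brocot tree *)

Section Stern.
Local Open Scope nat_scope.

Lemma sum_sqr_le (r : seq nat) (F : nat -> nat) :
  (\sum_(i <- r) F i) ^ 2 <= size r * \sum_(i <- r) F i ^ 2.
Proof.
rewrite -(leq_pmul2l (isT : 0 < 2)) -mulnn big_distrlr /=.
have -> : 2 * (size r * \sum_(i <- r) F i ^ 2) =
    \sum_(i <- r) \sum_(j <- r) (F i ^ 2 + F j ^ 2).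
  pose S := \sum_(i <- r) F i ^ 2.
  rewrite [RHS](eq_bigr (fun i => size r * F i ^ 2 + S)) => [|i _].
    rewrite big_split /= -big_distrr /= big_const_seq count_predT iter_addn_0 -/S.
    lia.
  by rewrite big_split /= big_const_seq count_predT iter_addn_0 mulnC.
rewrite big_distrr /=; apply: leq_sum => i _.
by rewrite big_distrr /=; apply: leq_sum => j _; apply: nat_Cauchy.
Qed.

(** The sum of [f] is the sum over its values [v] of [v] times the multiplicity
    of [v], hence at least the sum of the squares of the multiplicities. *)
Lemma image_size_lower_bound (T : eqType) (s : seq T) (f : T -> nat) :
  (forall v, count (fun x => f x == v) s <= v) ->
  size s ^ 2 <= size (undup (map f s)) * \sum_(x <- s) f x.
Proof.
move=> mult; set r := map f s.
have cnt v : count_mem v r <= v by rewrite count_map; apply: mult.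
have -> : size s = \sum_(v <- undup r) count_mem v r.
  have := big_undup_iterop_count addn r xpredT (fun=> 1).
  rewrite sum1_size size_map => <-; apply: eq_bigr => v _.
  by rewrite Monoid.iteropE iter_addn_0 mul1n.
apply: leq_trans (sum_sqr_le _ _) _; rewrite leq_mul2l; apply/orP; right.
rewrite -(big_map f xpredT id) -/r -(big_undup_iterop_count addn r xpredT id).
apply: leq_sum => v _.
by rewrite Monoid.iteropE iter_addn_0 -mulnn leq_mul2r cnt orbT.
Qed.

Fixpoint words m : seq (seq bool) :=
  if m is m'.+1 then map (cons true) (words m') ++ map (cons false) (words m')
  else [:: [::]].

Lemma size_words m : size (words m) = 2 ^ m.
Proof. by elim: m => //= m IHm; rewrite size_cat !size_map IHm expnS; lia. Qed.

Lemma mem_words m w : w \in words m -> size w = m.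
Proof.
elim: m w => [|m IHm] w /=; first by rewrite inE => /eqP->.
by rewrite mem_cat => /orP[] /mapP[v /IHm <- ->].
Qed.

Lemma uniq_words m : uniq (words m).
Proof.
elim: m => //= m IHm; rewrite cat_uniq !map_inj_uniq ?IHm; try by move=> ? ? [].
rewrite andbT /=; apply/hasPn => _ /mapP[v _ ->]; apply/mapP => -[u _].
by [].
Qed.

(** The node of the Stern-Brocot tree reached by [w], whose last move is the
    head of the list. *)
Fixpoint stern (w : seq bool) : nat * nat :=
  if w is b :: w' then
    let: (y, z) := stern w' in if b then (y, y + z) else (y + z, z)
  else (1, 1).

Lemma stern_gt0 w : 0 < (stern w).1 /\ 0 < (stern w).2.
Proof. by elim: w => //= -[] w; case: (stern w) => y z /= []; lia. Qed.

(** The last move is the one which made its entry the larger of the two. *)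
Lemma stern_inj w v : size w = size v -> stern w = stern v -> w = v.
Proof.
elim: w v => [|a w IHw] [|b v] //= [Es].
have := stern_gt0 w; have := stern_gt0 v; have := IHw v Es.
case: (stern w) (stern v) => [y z] [y' z'] /= IH [y0 z0] [y0' z0'].
case: a; case: b => -[E1 E2].
- by rewrite IH //; congr (_, _); lia.
- lia.
- lia.
- by rewrite IH //; congr (_, _); lia.
Qed.

Definition stern_sum w := (stern w).1 + (stern w).2.

Lemma sum_stern_sum m : \sum_(w <- words m) stern_sum w = 2 * 3 ^ m.
Proof.
elim: m => [|m IHm]; first by rewrite big_seq1.
rewrite /= big_cat !big_map /= expnS mulnCA -IHm -big_split big_distrr /=.
by apply: eq_bigr => w _; rewrite /stern_sum /=; case: (stern w) => y z /=; lia.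
Qed.

(** A word is determined by its pair, hence by its entry sum [v] and its first entry,
    which is less than [v]. *)
Lemma stern_multiplicity m v : count (fun w => stern_sum w == v) (words m) <= v.
Proof.
rewrite -size_filter -(size_map (fun w => (stern w).1)) -[v in _ <= v](size_iota 0).
apply: uniq_leq_size.
  rewrite map_inj_in_uniq; first exact/filter_uniq/uniq_words.
  move=> w u; rewrite !mem_filter => /andP[/eqP sw /mem_words ws].
  move=> /andP[/eqP su /mem_words us] E; apply: stern_inj; first by rewrite us.
  move: sw su E; rewrite /stern_sum.
  by case: (stern w) (stern u) => [y z] [y' z'] /= ? ? ?; congr (_, _); lia.
move=> y /mapP[w]; rewrite mem_filter => /andP[/eqP sw _] ->.
by rewrite mem_iota -sw /stern_sum; have := stern_gt0 w; lia.
Qed.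

Lemma many_stern_sums m :
  4 ^ m <= size (undup (map stern_sum (words m))) * (2 * 3 ^ m).
Proof.
rewrite -sum_stern_sum -[4]/(2 ^ 2) -expnM mulnC expnM -size_words.
exact/image_size_lower_bound/stern_multiplicity.
Qed.

End Stern.

(** * The exponential lower bound *)

Definition disc_polynomial (s : seq bool) : {poly int} :=
  let v := weights 'X s in
  'X * ('X - 1) * ('X - 2%:R) * (v.1.2 + ('X - 3%:R) * v.2).

Lemma horner_natr (R : comNzRingType) (a : R) n : (n%:R : {poly R}).[a] = n%:R.
Proof. by rewrite hornerMn hornerC. Qed.

Lemma horner1 (R : comNzRingType) (a : R) : (1 : {poly R}).[a] = 1.
Proof. exact: hornerC. Qed.

Definition horner_ringE :=
  (horner_natr, horner1, hornerD, hornerN, hornerM, hornerX).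

Lemma horner_weights (R : comNzRingType) (a : R) s :
  let v := weights ('X : {poly R}) s in
  weights a s = (v.1.1.1.[a], v.1.1.2.[a], v.1.2.[a], v.2.[a]).
Proof.
elim: s => [|b s IHs] /=; first by rewrite !hornerE.
rewrite IHs; case: (weights _ s) => [[[x y] z] w] /=.
by case: b; rewrite /= !horner_ringE.
Qed.

Lemma disc_polynomialP s :
  chromatic_polynomials (4 + size s) (disc_polynomial s).
Proof.
have [G [triG cardG colG]] := disc_sphere s.
exists G; split; rewrite ?cardG ?nvert_disc_of // => -[//|k] _.
rewrite colG closed_colorings (horner_weights k.+1%:R) /=.
by rewrite /disc_polynomial !horner_ringE.
Qed.

(** The first move, listed last, leads from the initial square to the root (1, 1) of
    the tree, up to sign. *)
Lemma weights2 s :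
  let y := ((stern s).1)%:R in let z := ((stern s).2)%:R in
  let e := (-1) ^+ (size s).+1 in
  weights (2%:R : int) (rcons s true) = (0, e * y, e * z, e * (y + z)).
Proof.
elim: s => [|b s IHs] /=; first by congr (_, _, _, _); rewrite expr1; ring.
rewrite IHs; case: (stern s) b => y z [] /=; rewrite !exprS !natrD;
  by congr (_, _, _, _); ring.
Qed.

Definition slope2 (p : {poly int}) : nat := `|p^`().[2%:R]|%N.

Lemma slope_at_root (R : comNzRingType) (a : R) (h : {poly R}) :
  (('X - a%:P) * h)^`().[a] = h.[a].
Proof.
by rewrite derivM derivXsubC mul1r hornerD hornerM hornerXsubC subrr mul0r addr0.
Qed.

(** A last move of the other kind, followed by the outer diagonal, reads off the
    entry sum. *)
Lemma slope2_disc s :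
  slope2 (disc_polynomial (false :: rcons s true)) = (2 * stern_sum s)%N.
Proof.
have := horner_weights (2%:R : int) (false :: rcons s true).
rewrite [weights 2%:R _]/= weights2 /slope2 /disc_polynomial.
case: (weights 'X (false :: rcons s true)) => [[[x y] z] w] /= [_ _ Ez Ew].
rewrite [_ * ('X - 2%:R)]mulrC -mulrA -polyC_natr slope_at_root.
rewrite !horner_ringE -Ez -Ew /stern_sum.
set n := (size s).+1; set u := (stern s).1; set v := (stern s).2.
have -> : 2%:R * (2%:R - 1) * (0 + (2%:R - 3%:R) * ((-1) ^+ n * v%:R) +
    (2%:R - 3%:R) * ((-1) ^+ n * u%:R +
      (2%:R - 4%:R) * ((-1) ^+ n * (u%:R + v%:R)))) =
    2%:R * ((-1) ^+ n * (u + v)%N%:R) :> int by rewrite natrD; ring.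
by rewrite abszM abszMsign !natz.
Qed.

(** The words have length [m + 2] because of the first and last moves, and the
    initial square has 4 vertices. *)
Lemma num_chromatic_polynomials_ge m :
  (4 ^ m <= num_chromatic_polynomials (m + 6) * (2 * 3 ^ m))%N.
Proof.
apply: leq_trans (many_stern_sums m) _; rewrite leq_mul2r; apply/orP; right.
have -> : num_chromatic_polynomials (m + 6) =
    size [seq (slope2 p %/ 2)%N | p <- fset_set (chromatic_polynomials (m + 6))].
  by rewrite size_map.
apply: uniq_leq_size; first exact: undup_uniq.
move=> v; rewrite mem_undup => /mapP[s /mem_words ss ->].
apply/mapP; exists (disc_polynomial (false :: rcons s true)).
  rewrite in_fset_set; last exact: finite_chromatic_polynomials.
  rewrite mem_set //; have := disc_polynomialP (false :: rcons s true).
  by rewrite /= size_rcons ss (_ : 4 + m.+2 = m + 6)%N; last lia.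
by rewrite slope2_disc mulKn.
Qed.

Lemma bernoulli (R : realFieldType) (x : R) m : 0 <= x ->
  1 + m%:R * x <= (1 + x) ^+ m.
Proof.
move=> x0; elim: m => [|m IHm]; first by rewrite mul0r addr0 expr0.
rewrite exprS; have : 0 <= (m%:R : R) by [].
have : (1 + x) * (1 + m%:R * x) <= (1 + x) * (1 + x) ^+ m.
  by apply: ler_wpM2l => //; lra.
rewrite -natr1; nra.
Qed.

Theorem theorem1p3 (R : realType) :
  exists c C : R, [/\ 1 < c, c <= C &
    exists N : nat, forall n : nat, (N <= n)%N ->
      c ^+ n <= (num_chromatic_polynomials n)%:R /\
      (num_chromatic_polynomials n)%:R <= C ^+ n].
Proof.
(* Any [c] below the growth rate 4 / 3 of the number of entry sums would do. *)
exists (9%:R / 8%:R), (4%:R ^+ 6); split; [lra | by rewrite !exprS expr0; lra |].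
exists 33%N => n n33; split; last first.
  by rewrite -exprM -natrX ler_nat; apply: num_chromatic_polynomials_le.
(* From [m = 27] on, the quotient (4 / 3) / (9 / 8) = 32 / 27, raised to the
   power [m], absorbs the constants. *)
have [m En m27] : exists2 m, n = (m + 6)%N & (27 <= m)%N.
  by exists (n - 6)%N; lia.
rewrite {n n33}En; set a := num_chromatic_polynomials _.
have growth : (4%:R / 3%:R) ^+ m <= 2%:R * a%:R :> R.
  have := num_chromatic_polynomials_ge m; rewrite -(ler_nat R) !natrM !natrX => ge.
  rewrite expr_div_n ler_pdivrMr ?exprn_gt0 //.
  by apply: le_trans ge _; rewrite -/a; lra.
have big : 6%:R <= (32%:R / 27%:R) ^+ m :> R.
  have := @bernoulli R (5%:R / 27%:R) m; have : 27%:R <= m%:R :> R by rewrite ler_nat.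
  have -> : 1 + 5%:R / 27%:R = 32%:R / 27%:R :> R by field.
  lra.
have c6 : (9%:R / 8%:R) ^+ 6 <= 3%:R :> R by rewrite !exprS expr0; lra.
have Em : (4%:R / 3%:R) ^+ m = (9%:R / 8%:R) ^+ m * (32%:R / 27%:R) ^+ m :> R.
  by rewrite -exprMn; congr (_ ^+ _); field.
have cm0 : 0 < (9%:R / 8%:R) ^+ m :> R by apply: exprn_gt0; lra.
rewrite exprD; rewrite Em in growth; nra.
Qed.
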